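(* Let $G_1,G_2,G$ be simple, simply connected complex Lie groups with Lie algebras $\mathfrak g_1,\mathfrak g_2,\mathfrak g$, and let $\phi:\mathfrak g_1\oplus\mathfrak g_2\to\mathfrak g$ be an embedding of Lie algebras induced by a homomorphism $G_1\times G_2\to G$, with Dynkin multi-index $(\ell_1,\ell_2)$, and with Cartan subalgebras $\mathfrak h_1,\mathfrak h_2,\mathfrak h$ satisfying $\phi(\mathfrak h_1\oplus\mathfrak h_2)\subset\mathfrak h$. Let $\mathfrak X$ be the data of $n$ distinct points on $\mathbb P^1$ with chosen coordinates. Let $\vec\lambda=(\lambda_1,\dots,\lambda_n)\in P_{\ell_1}(\mathfrak g_1)^n$, $\vec\gamma=(\gamma_1,\dots,\gamma_n)\in P_{\ell_2}(\mathfrak g_2)^n$ and $\vec\Lambda=(\Lambda_1,\dots,\Lambda_n)\in P_1(\mathfrak g)^n$ be such that for each $i$ the module $\mathcal H_{\lambda_i}\otimes\mathcal H_{\gamma_i}$ appears in the branching of $\mathcal H_{\Lambda_i}$ with multiplicity one. Let $\mu_1,\dots,\mu_n$ be coweights of $(\mathfrak g_2,\mathfrak h_2)$ with $\sum_{i=1}^n\mu_i=0$ such that each $\phi(\mu_i)$ is a coweight of $(\mathfrak g,\mathfrak h)$; let $\omega_i$ be the diagram automorphism attached to $\mu_i$ and $\Omega_i$ the diagram automorphism attached to $\phi(\mu_i)$, and put $\vec\omega\vec\gamma=(\omega_1^*\gamma_1,\dots,\omega_n^*\gamma_n)$, $\vec\Omega\vec\Lambda=(\Omega_1^*\Lambda_1,\dots,\Omega_n^*\Lambda_n)$.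 Then the following are equivalent: (1) the rank-level duality map $\mathcal V_{\vec\lambda}(\mathfrak X,\mathfrak g_1,\ell_1)\otimes\mathcal V_{\vec\gamma}(\mathfrak X,\mathfrak g_2,\ell_2)\to\mathcal V_{\vec\Lambda}(\mathfrak X,\mathfrak g,1)$ is nondegenerate; (2) the rank-level duality map $\mathcal V_{\vec\lambda}(\mathfrak X,\mathfrak g_1,\ell_1)\otimes\mathcal V_{\vec\omega\vec\gamma}(\mathfrak X,\mathfrak g_2,\ell_2)\to\mathcal V_{\vec\Omega\vec\Lambda}(\mathfrak X,\mathfrak g,1)$ is nondegenerate.
   Context: For a simple complex Lie algebra $\mathfrak a$ with Cartan subalgebra $\mathfrak t$ and root set $\Delta$, coweights are the $x\in\mathfrak t$ with $\alpha(x)\in\mathbb Z$ for all $\alpha\in\Delta$; $\langle\,,\,\rangle_{\mathfrak a}$ is the Cartan–Killing form normalized so that the longest root $\theta$ has squared length $2$; and $\widehat{\mathfrak a}=\mathfrak a\otimes\mathbb C((\xi))\oplus\mathbb Cc$, with $c$ central and $[X\otimes f,Y\otimes g]=[X,Y]\otimes fg+\langle X,Y\rangle_{\mathfrak a}\operatorname{Res}_{\xi=0}(g\,df)\,c$. $P_\ell(\mathfrak a)$ is the set of dominant integral weights $\lambda$ with $(\lambda,\theta)\le\ell$. For $\lambda\in P_\ell(\mathfrak a)$, $\mathcal H_\lambda$ is the irreducible integrable highest weight $\widehat{\mathfrak a}$-module of highest weight $\lambda$ on which $c$ acts by $\ell$. Conformal blocks: $\mathfrak X$ consists of distinct points $P_1,\dots,P_n\in\mathbb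 P^1$ with a formal coordinate $\xi_i$ at each $P_i$. For $\vec\lambda\in P_\ell(\mathfrak a)^n$ put $\mathcal H_{\vec\lambda}=\mathcal H_{\lambda_1}\otimes\cdots\otimes\mathcal H_{\lambda_n}$. The algebra $\mathfrak a(\mathfrak X)=\mathfrak a\otimes\Gamma(\mathbb P^1\setminus\{P_1,\dots,P_n\},\mathcal O)$ acts on $\mathcal H_{\vec\lambda}$ by sending $X\otimes f$ to the sum over $i$ of the action on the $i$-th factor of $X\otimes(\text{Laurent expansion of } f \text{ in }\xi_i)$. Put $\mathcal V_{\vec\lambda}(\mathfrak X,\mathfrak a,\ell)=\mathcal H_{\vec\lambda}/\mathfrak a(\mathfrak X)\mathcal H_{\vec\lambda}$ (dual conformal blocks). Write $\phi_i=\phi|_{\mathfrak g_i}$. The Dynkin multi-index is defined by $\langle\phi_i(X),\phi_i(Y)\rangle_{\mathfrak g}=\ell_i\langle X,Y\rangle_{\mathfrak g_i}$. Modules over $\widehat{\mathfrak g}$ are restricted to $\widehat{\mathfrak g}_1\oplus\widehat{\mathfrak g}_2$ via $\widehat\phi$, where $\widehat\phi(X\otimes f+a\,c)=\phi_i(X)\otimes f+a\,\ell_i\,c$ on $\widehat{\mathfrak g}_i$. ''Multiplicity one'' means that $\operatorname{Hom}_{\widehat{\mathfrak g}_1\oplus\widehat{\mathfrak g}_2}(\mathcal H_{\lambda_i}\otimes\mathcal H_{\gamma_i},\mathcal H_{\Lambda_i})$ is one-dimensional. The tensor product over $i$ of nonzero such homomorphisms gives a map $\mathcal H_{\vec\lambda}\otimes\mathcal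 H_{\vec\gamma}\to\mathcal H_{\vec\Lambda}$, which descends to coinvariants; the induced map $\mathcal V_{\vec\lambda}(\mathfrak X,\mathfrak g_1,\ell_1)\otimes\mathcal V_{\vec\gamma}(\mathfrak X,\mathfrak g_2,\ell_2)\to\mathcal V_{\vec\Lambda}(\mathfrak X,\mathfrak g,1)$, well defined up to a nonzero scalar, is the rank-level duality map. It is nondegenerate if, viewed as a bilinear map $B(v,w)$, $B(v,\cdot)=0$ implies $v=0$ and $B(\cdot,w)=0$ implies $w=0$. Diagram automorphism attached to a coweight: for a coweight $\nu$ of $(\mathfrak a,\mathfrak t)$, the single-shift automorphism $\sigma_\nu$ of $\widehat{\mathfrak a}$ is given by $\sigma_\nu(c)=c$, $\sigma_\nu(h\otimes f)=h\otimes f+\langle\nu,h\rangle_{\mathfrak a}\operatorname{Res}_{\xi=0}(\xi^{-1}f\,d\xi)\,c$ for $h\in\mathfrak t$, and $\sigma_\nu(X_\alpha\otimes f)=X_\alpha\otimes\xi^{\alpha(\nu)}f$ for root vectors $X_\alpha$. Its outer class is that of a diagram automorphism $\omega$ of the affine Dynkin diagram of $\widehat{\mathfrak a}$, which induces a permutation $\omega^*$ of $P_\ell(\mathfrak a)$ by permuting the affine fundamental weights, $\omega^*(\Lambda_j)=\Lambda_{\omega j}$. Equivalently, $\omega^*\lambda$ is the element of $P_\ell(\mathfrak a)$ for which there is a linear isomorphism $\Theta:\mathcal H_\lambda\to\mathcal H_{\omega^*\lambda}$ with $\Theta(Xv)=\sigma_\nu(X)\Theta(v)$ for all $X\in\widehat{\mathfrak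 a}$, $v\in\mathcal H_\lambda$. *)

(* Defs.v *)
From HB Require Import structures.
From mathcomp Require Import all_boot all_order all_algebra zify ring.
From mathcomp Require Import finmap mathcomp_extra boolp classical_sets functions.
From mathcomp Require Import cardinality fsbigop reals complex freeg.

Set Implicit Arguments.
Unset Strict Implicit.
Unset Printing Implicit Defensive.

Import Order.TTheory GRing.Theory Num.Theory.
Local Open Scope classical_set_scope.
Local Open Scope ring_scope.

(* Formal Laurent series: x k is the coefficient of xi^k. *)
Section Laurent.
Variables (K : fieldType) (V : lmodType K).

Definition bounded_below : {pred int -> V} :=
  fun x => `[< exists N : int, forall k : int, k < N -> x k = 0 >].

Lemma bounded_below_submod : submod_closed bounded_below.
Proof.
split; first by apply/asboolP; exists 0.
move=> a x y /asboolP[N xN] /asboolP[M yM]; apply/asboolP.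
exists (Order.min N M) => k; rewrite lt_min => /andP[kN kM].
by rewrite /GRing.add/= /GRing.scale/= xN// yM// scaler0 addr0.
Qed.

HB.instance Definition _ :=
  GRing.isSubmodClosed.Build K (int -> V) bounded_below bounded_below_submod.

Record laurent := Laurent
  { lcoef :> int -> V; lcoef_bounded : lcoef \in bounded_below }.

HB.instance Definition _ := [isSub for lcoef].
HB.instance Definition _ := [Choice of laurent by <:].
HB.instance Definition _ := [SubChoice_isSubLmodule of laurent by <:].

Lemma laurentP (x y : laurent) : (forall k, x k = y k) <-> x = y.
Proof. by split=> [xy|->//]; apply/val_inj/funext. Qed.

Lemma laurentD (x y : laurent) k : (x + y) k = x k + y k.
Proof. by []. Qed.

Lemma laurentZ a (x : laurent) k : (a *: x) k = a *: x k.
Proof. by []. Qed.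

Lemma laurent0 k : (0 : laurent) k = 0.
Proof. by []. Qed.

Lemma laurent_bound (x : laurent) : exists N : int, forall k : int, k < N -> x k = 0.
Proof. by have /asboolP := lcoef_bounded x. Qed.

End Laurent.
Arguments laurent0 {K V}.

Section Convolution.
Variables (K : fieldType) (U V W : lmodType K) (b : U -> V -> W).
Hypotheses (b0l : forall v, b 0 v = 0) (b0r : forall u, b u 0 = 0).

(* All but finitely many terms of the sum vanish. *)
Definition conv_coef (x : laurent U) (y : laurent V) (k : int) : W :=
  \sum_(i \in [set: int]) b (x i) (y (k - i)).

Lemma conv_coefE (x : laurent U) (y : laurent V) (k N M A : int) (m : nat) :
  (forall i, i < N -> x i = 0) -> (forall i, i < M -> y i = 0) ->
  A <= N -> k - M < A + m%:Z ->
  conv_coef x y k = \sum_(j < m) b (x (A + j%:Z)) (y (k - (A + j%:Z))).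
Proof.
move=> xN yM AN km.
rewrite /conv_coef (fsbigE [seq A + j%:Z | j <- iota 0 m])//; first last.
- move=> i _ /negP iA; have [iN|Ni] := ltP i N; first by rewrite xN ?b0l.
  have [kM|Mk] := ltP (k - i) M; first by rewrite yM ?b0r.
  exfalso; apply: iA; apply/mapP; exists `|i - A|%N; last by lia.
  by rewrite mem_iota; lia.
- by rewrite map_inj_uniq ?iota_uniq// => i j /addrI[].
under eq_bigl do rewrite in_setT.
by rewrite big_map -[X in iota 0 X]subn0 big_mkord.
Qed.

Lemma conv_subproof x y : conv_coef x y \in @bounded_below K W.
Proof.
have [N xN] := laurent_bound x; have [M yM] := laurent_bound y.
apply/asboolP; exists (N + M) => k kNM.
by rewrite (@conv_coefE _ _ _ N M N 0)// ?big_ord0//; lia.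
Qed.

Definition conv x y : laurent W := Laurent (conv_subproof x y).

End Convolution.

(* The K-algebra K((xi)). *)
Definition series (K : fieldType) := laurent K^o.

Section Series.
Variable K : fieldType.
Local Notation series := (series K).
Implicit Types x y z : series.

HB.instance Definition _ := GRing.Lmodule.on series.

Lemma seriesD x y k : (x + y) k = x k + y k.
Proof. by []. Qed.

Lemma seriesZ (a : K) x k : (a *: x) k = a * x k.
Proof. by []. Qed.

Definition smul x y : series :=
  conv (b := *%R : K^o -> K^o -> K^o) (@mul0r _) (@mulr0 _) x y.

Lemma smulE x y (k N M A : int) (m : nat) :
  (forall i, i < N -> x i = 0) -> (forall i, i < M -> y i = 0) ->
  A <= N -> k - M < A + m%:Z ->
  smul x y k = \sum_(j < m) x (A + j%:Z) * y (k - (A + j%:Z)).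
Proof.
exact: (conv_coefE (b := *%R : K^o -> K^o -> K^o) (@mul0r _) (@mulr0 _)).
Qed.

Lemma xi_subproof (k : int) :
  (fun i => (i == k)%:R : K^o) \in @bounded_below K K^o.
Proof. by apply/asboolP; exists k => i ik; rewrite lt_eqF. Qed.

(* xi k is the monomial xi^k. *)
Definition xi (k : int) : series := Laurent (xi_subproof k).

Lemma smulC : commutative smul.
Proof.
move=> x y; apply/laurentP => k /=; rewrite /conv_coef.
have bij : bijective (fun i : int => k - i) by exists (fun i => k - i) => i; lia.
rewrite (reindex_fsbigT _ _ bij); apply: eq_fsbigr => i _ /=.
by rewrite [LHS]mulrC; congr (y _ * _); lia.
Qed.

Lemma smulA : associative smul.
Proof.
move=> x y z; have [Nx xN] := laurent_bound x.
have [Ny yN] := laurent_bound y; have [Nz zN] := laurent_bound z.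
pose N : int := Order.min Nx (Order.min Ny Nz).
have {}xN i : i < N -> x i = 0 by move=> iN; apply: xN; lia.
have {}yN i : i < N -> y i = 0 by move=> iN; apply: yN; lia.
have {}zN i : i < N -> z i = 0 by move=> iN; apply: zN; lia.
have vanish (u v : series) : (forall i, i < N -> u i = 0) ->
    (forall i, i < N -> v i = 0) -> forall i, i < N + N -> smul u v i = 0.
  move=> uN vN i iN; rewrite (smulE (N := N) (M := N) (A := N) (m := 0))//.
    by rewrite big_ord0.
  by lia.
apply/laurentP => k; pose m := (absz (k - (N + N + N))%R).+1.
rewrite (smulE (N := N) (M := N + N) (A := N) (m := m))//; last 2 first.
- exact: vanish.
- by rewrite /m; lia.
rewrite [RHS](smulE (N := N + N) (M := N) (A := N + N) (m := m))//; last 2 first.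
- exact: vanish.
- by rewrite /m; lia.
transitivity (\sum_(a < m) \sum_(j < m) x (N + j%:Z) *
   (y (N - j%:Z + a%:Z) * z (k - (N + j%:Z) - (N - j%:Z + a%:Z)))).
  rewrite exchange_big/=; apply: eq_bigr => j _; rewrite -mulr_sumr.
  congr (_ * _); apply: (smulE (N := N) (M := N)) => //; first by lia.
  by rewrite /m; lia.
apply: eq_bigr => a _.
rewrite (smulE (N := N) (M := N) (A := N) (m := m) xN yN)//; last first.
  by have := ltn_ord a; lia.
rewrite mulr_suml; apply: eq_bigr => j _; rewrite -mulrA.
by congr (_ * (y _ * z _)); lia.
Qed.

Lemma smul1 : left_id (xi 0) smul.
Proof.
move=> x; apply/laurentP => k /=; rewrite /conv_coef/=.
rewrite (@fsbigTE _ _ _ _ [fset 0]%fset)/=.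
  by rewrite big_seq_fset1 eqxx mul1r subr0.
by move=> i; rewrite inE => /negbTE ->; rewrite mul0r.
Qed.

Lemma smulDl : left_distributive smul +%R.
Proof.
move=> x y z; have [Nx xN] := laurent_bound x.
have [Ny yN] := laurent_bound y; have [Nz zN] := laurent_bound z.
apply/laurentP => k; pose N : int := Order.min Nx (Order.min Ny Nz).
have {}xN i : i < N -> x i = 0 by move=> iN; apply: xN; lia.
have {}yN i : i < N -> y i = 0 by move=> iN; apply: yN; lia.
have {}zN i : i < N -> z i = 0 by move=> iN; apply: zN; lia.
have xyN i : i < N -> (x + y) i = 0.
  by move=> iN; rewrite seriesD xN ?yN ?addr0.
pose m := (absz (k - (N + N))%R).+1.
have km : k - N < N + m%:Z by rewrite /m; lia.
rewrite seriesD (smulE (k := k) xN zN (lexx N) km).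
rewrite (smulE (k := k) yN zN (lexx N) km) (smulE (k := k) xyN zN (lexx N) km).
by rewrite -big_split; apply: eq_bigr => j _; exact: mulrDl.
Qed.

Lemma sone_neq0 : xi 0 != 0.
Proof.
by apply/negP => /eqP/laurentP/(_ 0)/eqP/=; rewrite oner_eq0.
Qed.

HB.instance Definition _ := GRing.Zmodule_isComNzRing.Build series
  smulA smulC smul1 smulDl sone_neq0.

Lemma sscaleAl (a : K) x y : a *: (x * y) = (a *: x) * y.
Proof.
have [N xN] := laurent_bound x; have [M yM] := laurent_bound y.
have axN i : i < N -> (a *: x) i = 0 by move=> iN; rewrite seriesZ xN ?mulr0.
apply/laurentP => k; rewrite seriesZ.
have km : k - M < N + (absz (k - (N + M))%R).+1%:Z by lia.
rewrite [X in a * X](smulE (k := k) xN yM (lexx N) km).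
rewrite [RHS](smulE (k := k) axN yM (lexx N) km).
by rewrite mulr_sumr; apply: eq_bigr => j _; rewrite seriesZ mulrA.
Qed.

HB.instance Definition _ := GRing.Lmodule_isLalgebra.Build K series sscaleAl.
HB.instance Definition _ := GRing.Lalgebra_isComAlgebra.Build K series.

(* The residue of f dxi. *)
Definition res (f : series) : K := f (-1).

End Series.

Section LaurentTools.
Variables (K : fieldType) (V W : lmodType K).

Lemma tens_subproof (v : V) (f : series K) :
  (fun k => (f k : K) *: v) \in @bounded_below K V.
Proof.
by have [N fN] := laurent_bound f; apply/asboolP; exists N => k /fN ->; rewrite scale0r.
Qed.

(* The pure tensor v (x) f in V (x) K((xi)). *)
Definition tens (v : V) (f : series K) : laurent V := Laurent (tens_subproof v f).

Lemma lmap_subproof (f : {linear V -> W}) (x : laurent V) :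
  (fun k => f (x k)) \in @bounded_below K W.
Proof.
by have [N xN] := laurent_bound x; apply/asboolP; exists N => k /xN ->; rewrite linear0.
Qed.

Definition lmap (f : {linear V -> W}) (x : laurent V) : laurent W :=
  Laurent (lmap_subproof f x).

End LaurentTools.

(* Quotient of V by the subspace spanned by S. *)
Section QuotientSpace.
Variables (K : fieldType) (V : lmodType K).
Implicit Types (S W : set V).

Definition is_subspace W : Prop :=
  W 0 /\ forall a x y, W x -> W y -> W (a *: x + y).

Definition span_pred S : {pred V} :=
  fun v => `[< forall W, is_subspace W -> S `<=` W -> W v >].

Lemma span_submod S : submod_closed (span_pred S).
Proof.
split; first by apply/asboolP => W [].
move=> a x y /asboolP xS /asboolP yS; apply/asboolP => W Wsub SW.
by apply: Wsub.2; [exact: xS|exact: yS].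
Qed.

HB.instance Definition _ S :=
  GRing.isSubmodClosed.Build K V (span_pred S) (span_submod S).

Variable S : set V.

Definition quot : Type := {ideal_quot (span_pred S)}.

HB.instance Definition _ := GRing.Zmodule.on quot.

Definition proj (v : V) : quot := \pi_({ideal_quot (span_pred S)})%qT v.

Lemma projP (x y : V) : proj x = proj y <-> x - y \in span_pred S.
Proof.
split=> [/eqP|xy]; first by rewrite -Quotient.idealrBE.
by apply/eqP; rewrite -Quotient.idealrBE.
Qed.

Lemma projD : {morph proj : x y / x + y}.
Proof. by move=> x y; rewrite /proj !piE. Qed.

Definition lift_repr (q : quot) : V := repr (q : {ideal_quot (span_pred S)}).

Lemma lift_reprK : cancel lift_repr proj.
Proof. by move=> q; rewrite /proj /lift_repr reprK. Qed.

Definition quot_scale (a : K) (q : quot) : quot := proj (a *: lift_repr q).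

Lemma quot_scaleE a v : quot_scale a (proj v) = proj (a *: v).
Proof.
by apply/projP; rewrite -scalerBr rpredZ//; apply/projP; rewrite lift_reprK.
Qed.

Lemma quot_scaleA a b q : quot_scale a (quot_scale b q) = quot_scale (a * b) q.
Proof. by rewrite -[q]lift_reprK !quot_scaleE scalerA. Qed.

Lemma quot_scale1 : left_id 1 quot_scale.
Proof. by move=> q; rewrite -[q]lift_reprK quot_scaleE scale1r. Qed.

Lemma quot_scaleDr : right_distributive quot_scale +%R.
Proof.
move=> a p q; rewrite -[p]lift_reprK -[q]lift_reprK.
by rewrite -projD !quot_scaleE scalerDr projD.
Qed.

Lemma quot_scaleDl q : {morph quot_scale^~ q : a b / a + b}.
Proof.
by move=> a b; rewrite -[q]lift_reprK !quot_scaleE scalerDl projD.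
Qed.

HB.instance Definition _ := GRing.Zmodule_isLmodule.Build K quot
  quot_scaleA quot_scale1 quot_scaleDr quot_scaleDl.

End QuotientSpace.

(* H_0 (x) ... (x) H_(n-1), as the free module on tuples of vectors modulo the
   multilinearity relations. *)
Section Tensor.
Variables (K : fieldType) (n : nat) (H : 'I_n -> lmodType K).

Definition multilinear_rel : set {freeg (forall i, H i) / K} :=
  [set r | exists (v : forall i, H i) (i : 'I_n) (a : K) (x y : H i),
    r = << dfwith v i (a *: x + y) >>
        - (a *: << dfwith v i x >> + << dfwith v i y >>)].

Definition tensor : Type := quot multilinear_rel.
HB.instance Definition _ := GRing.Lmodule.on tensor.

Definition ptens (v : forall i, H i) : tensor := proj multilinear_rel << v >>.

End Tensor.

(* Finite-dimensional Lie algebras. *)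
HB.mixin Record Vector_isLie (K : fieldType) (L : Type) of Vector K L := {
  lie : L -> L -> L;
  lie_linearl : forall y, linear (lie^~ y);
  lie_linearr : forall x, linear (lie x);
  lie_alt : forall x, lie x x = 0;
  lie_jacobi : forall x y z,
    lie x (lie y z) + lie y (lie z x) + lie z (lie x y) = 0
}.

#[short(type="lieAlgType")]
HB.structure Definition LieAlg (K : fieldType) :=
  {L of Vector_isLie K L & Vector K L}.

Section LieTheory.
Variables (K : numFieldType) (L : lieAlgType K).

Lemma lie0r (x : L) : lie x 0 = 0.
Proof. by have := lie_linearr x (-1) 0 0; rewrite scaler0 addr0 scaleN1r addNr. Qed.

Lemma lie0l (x : L) : lie 0 x = 0.
Proof. by have := lie_linearl x (-1) 0 0; rewrite scaler0 addr0 scaleN1r addNr. Qed.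

Definition is_simple : Prop :=
  (exists x y : L, lie x y <> 0) /\
  forall I : {vspace L}, (forall x y, y \in I -> lie x y \in I) ->
    I = 0%VS \/ I = fullv.

Definition ad_diagonalizable (x : L) : Prop :=
  exists e : seq L, basis_of fullv e /\
    forall y, y \in e -> exists c : K, lie x y = c *: y.

(* A toral subalgebra equal to its own centralizer, as is usual for semisimple
   Lie algebras. *)
Definition is_cartan (t : {vspace L}) : Prop :=
  [/\ forall x y, x \in t -> y \in t -> lie x y = 0,
      forall x, x \in t -> ad_diagonalizable x &
      forall x, (forall h, h \in t -> lie h x = 0) -> x \in t].

(* The trace of ad x \o ad y. *)
Definition killing (x y : L) : K :=
  \sum_(i < \dim {:L})
    coord (vbasis {:L}) i (lie x (lie y (vbasis {:L})`_i)).

Variables (t : {vspace L}) (B : L -> L -> K).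

Definition functional := 'Hom(subvs_of t, K^o).
Implicit Types (a b : functional) (P : set functional).

Definition in_root_space a (x : L) : Prop :=
  forall h : subvs_of t, lie (vsval h) x = (a h : K) *: x.

Definition root_set : set functional :=
  [set a | a <> 0 /\ exists2 x : L, x <> 0 & in_root_space a x].

Definition is_positive_system P : Prop :=
  [/\ P `<=` root_set,
      forall a, root_set a -> P a \/ P (- a),
      forall a, P a -> ~ P (- a) &
      forall a b, P a -> P b -> root_set (a + b) -> P (a + b)].

Definition is_highest_root P a : Prop :=
  root_set a /\ forall b, root_set b ->
    exists s : seq functional,
      (forall c, c \in s -> P c) /\ a = b + \sum_(c <- s) c.

(* The element of t representing a through B, and the induced form on t^*. *)
Definition dual_elt a : subvs_of t :=
  xget 0 [set u | forall h, B (vsval u) (vsval h) = a h].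

Definition dual_form a b : K := a (dual_elt b).

Definition coroot_elt a : subvs_of t := (2%:R / dual_form a a) *: dual_elt a.

End LieTheory.

(* A simple Lie algebra with a Cartan subalgebra, a choice of positive roots,
   and the invariant form for which the highest root (which is a longest root)
   has squared length 2. *)
Record simpleLie (K : numFieldType) := SimpleLie {
  lie_sort :> lieAlgType K;
  cartan : {vspace lie_sort};
  positive : set (functional cartan);
  theta : functional cartan;
  form : lie_sort -> lie_sort -> K;
  lie_simple : is_simple lie_sort;
  cartanP : is_cartan cartan;
  positiveP : is_positive_system positive;
  thetaP : is_highest_root positive theta;
  formP : exists s : K, forall x y, form x y = s * killing x y;
  form_theta : dual_form form theta theta = 2%:R
}.

Arguments positive {K} s _.
Arguments form {K s} x y.


(* Elements of the Cartan subalgebra, and weights as functionals on it. *)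
Notation cartan_elt g := (subvs_of (cartan g)).

Section Weights.
Variables (K : numFieldType) (g : simpleLie K).

Definition weight := functional (cartan g).
Implicit Types (a b lam : weight) (nu : cartan_elt g).

Definition is_root : set weight := @root_set K g (cartan g).
Definition coroot a : cartan_elt g := coroot_elt form a.

Definition is_coweight nu : Prop :=
  forall a, is_root a -> exists k : int, a nu = k%:~R :> K.

Definition dominant_integral lam : Prop :=
  forall a, positive g a -> exists m : nat, lam (coroot a) = m%:R :> K.

(* P_l(g). *)
Definition level_weights (l : nat) : set weight :=
  [set lam | dominant_integral lam /\ dual_form form lam (theta g) <= l%:R].

End Weights.

Section Affine.
Variables (K : numFieldType) (g : simpleLie K).

(* g (x) K((xi)) (+) K c, with c = cen. *)
Definition affine : Type := (laurent g * K^o)%type.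
HB.instance Definition _ := GRing.Lmodule.on affine.

Definition loop (X : g) (f : series K) : affine := (tens X f, 0).
Definition cen : affine := (0, 1).

Definition affine_lie (x y : affine) : affine :=
  (conv (b := @lie K g) (@lie0l K g) (@lie0r K g) x.1 y.1,
   \sum_(i \in [set: int]) i%:~R * form (x.1 i) (y.1 (- i))).

End Affine.
Arguments cen {K g}.

Section AffineBracket.
Variables (K : numFieldType) (g : simpleLie K).

Lemma formZ (a b : K) (x y : g) : form (a *: x) (b *: y) = a * b * form x y.
Proof.
have [s sE] := formP g; rewrite !sE /killing [RHS]mulrCA; congr (_ * _); rewrite mulr_sumr.
have lieZl c u v : lie (c *: u) v = c *: lie u v :> g.
  by have := lie_linearl v c u 0; rewrite lie0l !addr0.
have lieZr c u v : lie u (c *: v) = c *: lie u v :> g.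
  by have := lie_linearr u c v 0; rewrite lie0r !addr0.
by apply: eq_bigr => i _; rewrite lieZl lieZl lieZr !linearZ /= mulrA.
Qed.

Lemma sderiv_subproof (f : series K) :
  (fun k => (k + 1)%:~R * f (k + 1) : K^o) \in @bounded_below K K^o.
Proof.
have [N fN] := laurent_bound f; apply/asboolP; exists (N - 1) => k kN.
by rewrite fN ?mulr0//; lia.
Qed.

Definition sderiv (f : series K) : series K := Laurent (sderiv_subproof f).

Lemma affine_lieE (X Y : g) (f h : series K) :
  affine_lie (loop X f) (loop Y h) =
  loop (lie X Y) (f * h) + (form X Y * res (h * sderiv f)) *: cen.
Proof.
have lieZ a b : lie (a *: X) (b *: Y) = (a * b) *: lie X Y.
  have := lie_linearl (b *: Y) a X 0; rewrite lie0l !addr0 => ->.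
  by have := lie_linearr X b Y 0; rewrite lie0r !addr0 => ->; rewrite scalerA.
congr pair.
  rewrite /= scaler0 addr0; apply/laurentP => k.
  have [N fN] := laurent_bound f; have [M hM] := laurent_bound h.
  have km : k - M < N + (absz (k - (N + M))%R).+1%:Z by lia.
  have fhE : (f * h) k = _ := smulE (k := k) fN hM (lexx N) km.
  transitivity (((f * h) k : K) *: lie X Y) => //; rewrite fhE scaler_suml /=.
  rewrite (conv_coefE (k := k) (N := N) (M := M) (@lie0l K g) (@lie0r K g) _ _
    (lexx N) km); last 2 first.
  - by move=> i /fN fi; rewrite /= fi scale0r.
  - by move=> i /hM hi; rewrite /= hi scale0r.
  by apply: eq_bigr => j _; exact: lieZ.
rewrite /= add0r [RHS]mulr1 /res /= /conv_coef mulr_fsumr.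
have bij : bijective (fun i : int => - i) by exists (fun i => - i) => i; lia.
rewrite (reindex_fsbigT _ _ bij); apply: eq_fsbigr => i _ /=.
have -> : - 1 - i + 1 = - i :> int by lia.
rewrite opprK formZ; ring.
Qed.

End AffineBracket.

(* H_lam at level l: the irreducible integrable highest weight module. *)
Record hwModule (K : numFieldType) (g : simpleLie K) (l : nat) (lam : weight g) :=
HwModule {
  hw_sort :> lmodType K;
  act : affine g -> hw_sort -> hw_sort;
  act_linearl : forall v, linear (act^~ v);
  act_linearr : forall x, linear (act x);
  act_lie : forall x y v,
    act (affine_lie x y) v = act x (act y v) - act y (act x v);
  act_cen : forall v, act cen v = l%:R *: v;
  act_integrable : forall (a : weight g) (X : g) (k : int) (v : hw_sort),
    is_root a -> in_root_space a X ->
    exists m : nat, iter m (act (loop X (xi K k))) v = 0;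
  act_highest : exists2 v : hw_sort, v <> 0 &
    [/\ forall (X : g) (f : series K), (forall k, k < 1 -> f k = 0) ->
          act (loop X f) v = 0,
        forall (a : weight g) (X : g), positive g a -> in_root_space a X ->
          act (loop X 1) v = 0 &
        forall h : cartan_elt g, act (loop (vsval h) 1) v = (lam h : K) *: v];
  act_irreducible : forall W : set hw_sort, is_subspace W ->
    (forall x v, W v -> W (act x v)) -> W = [set 0] \/ W = setT
}.

Section DiagramAutomorphism.
Variables (K : numFieldType) (g : simpleLie K).
Implicit Types (a b lam : weight g) (nu : cartan_elt g).

(* The single-shift automorphism sigma_nu. *)
Definition is_shift nu (sigma : {linear affine g -> affine g}) : Prop :=
  [/\ sigma cen = cen,
      forall (h : cartan_elt g) (f : series K),
        sigma (loop (vsval h) f) =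
        loop (vsval h) f + (form (vsval nu) (vsval h) * res (xi K (- 1) * f)) *: cen &
      forall a (X : g) (f : series K) (k : int),
        is_root a -> in_root_space a X -> a nu = k%:~R :> K ->
        sigma (loop X f) = loop X (xi K k * f)].

Definition simple_root : set (weight g) :=
  [set a | positive g a /\
    ~ exists b c, [/\ positive g b, positive g c & a = b + c]].

(* The vertices of the affine Dynkin diagram, each represented by the finite
   part of the corresponding affine simple root. *)
Definition affine_node : set (weight g) :=
  [set a | simple_root a \/ a = - theta g].

Definition is_diagram_aut (w : weight g -> weight g) : Prop :=
  set_bij affine_node affine_node w /\
  forall a b, affine_node a -> affine_node b ->
    w a (coroot (w b)) = a (coroot b).

(* The coefficient, at the vertex a, of the level l affine weight with finite
   part lam in the basis of affine fundamental weights. *)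
Definition affine_label (l : nat) lam a : K :=
  lam (coroot a) + (if a == - theta g then l%:R else 0).

(* lam' = w^* lam. *)
Definition is_permuted (w : weight g -> weight g) (l : nat) lam lam' : Prop :=
  level_weights l lam' /\
  forall a, affine_node a -> affine_label l lam' (w a) = affine_label l lam a.

Definition shift_intertwined nu (l : nat) lam lam'
    (H : hwModule l lam) (H' : hwModule l lam') : Prop :=
  exists (sigma : {linear affine g -> affine g}) (Theta : {linear H -> H'}),
    [/\ is_shift nu sigma, bijective Theta &
        forall x v, Theta (act x v) = act (sigma x) (Theta v)].

(* w is the diagram automorphism whose action on the modules H_lam is that of
   the outer class of sigma_nu. *)
Definition is_attached nu (w : weight g -> weight g) : Prop :=
  is_diagram_aut w /\
  forall (l : nat) lam lam' (H : hwModule l lam) (H' : hwModule l lam'),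
    level_weights l lam -> is_permuted w l lam lam' ->
    shift_intertwined nu H H'.

End DiagramAutomorphism.

(* Distinct points of P^1 = K + {oo} (None is oo) with formal coordinates. The
   coordinate xi_i is recorded by the expansion, as a Laurent series in xi_i, of
   the affine coordinate z: xi_i is a formal coordinate at p <> oo exactly when
   z - p is a power series in xi_i of order one, and at oo exactly when 1/z is. *)
Record pointedLine (K : fieldType) (n : nat) := PointedLine {
  point : 'I_n -> option K;
  zexp : 'I_n -> series K;
  point_inj : injective point;
  zexpP : forall i,
    if point i is Some p then
      (zexp i - p *: 1) 1 <> 0 /\ forall k, k < 1 -> (zexp i - p *: 1) k = 0
    else zexp i (- 1) <> 0 /\ forall k, k < - 1 -> zexp i k = 0
}.

Section RationalFunctions.
Variables (K : fieldType) (n : nat) (X : pointedLine K n).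
Local Notation "p %:F" := (tofrac p) (at level 1).

(* The rational functions which are regular on P^1 away from the points. *)
Definition regular_away : set {fraction {poly K}} :=
  [set f | exists N D : {poly K},
    [/\ D != 0, f = N%:F / D%:F,
        forall p, root D p -> exists i, point X i = Some p &
        (exists i, point X i = None) \/ (size N <= size D)%N]].

Definition is_expansion (i : 'I_n) (f : {fraction {poly K}}) (s : series K) : Prop :=
  exists N D : {poly K}, [/\ D != 0, f = N%:F / D%:F &
    s * horner_alg (zexp X i) D = horner_alg (zexp X i) N].

End RationalFunctions.

Section Coinvariants.
Variables (K : numFieldType) (g : simpleLie K) (l n : nat).
Variables (X : pointedLine K n) (lam : 'I_n -> weight g).
Variable H : forall i, hwModule l (lam i).

(* (Y (x) f) . (v_0 (x) ... (x) v_(n-1)), when s i is the expansion of f at the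
   i-th point. *)
Definition gauge_act (Y : g) (s : 'I_n -> series K) (v : forall i, H i) :
    tensor H :=
  \sum_(i < n) ptens (dfwith v i (act (loop Y (s i)) (v i))).

(* Spans g(X) H. *)
Definition gauge_image : set (tensor H) :=
  [set t | exists (Y : g) f (s : 'I_n -> series K) (v : forall i, H i),
    [/\ regular_away X f, forall i, is_expansion X i f (s i) &
        t = gauge_act Y s v]].

Definition coinvariants : Type := quot gauge_image.
HB.instance Definition _ := GRing.Lmodule.on coinvariants.

Definition coinv_class (v : forall i, H i) : coinvariants :=
  proj gauge_image (ptens v).

End Coinvariants.

(* The linear extension of F to the free module. *)
Section FreeLift.
Variables (K : fieldType) (T : choiceType) (W : lmodType K).
Implicit Types (F : T -> W) (d : {freeg T / K}).

Definition flift F d : W := \sum_(v <- dom d) coeff v d *: F v.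

Lemma flift_widen F d (s : seq T) : uniq s -> {subset dom d <= s} ->
  flift F d = \sum_(v <- s) coeff v d *: F v.
Proof.
move=> s_uniq ds; rewrite /flift (bigID (mem (dom d)))/= [X in _ = X](bigID (mem (dom d)))/=.
congr (_ + _).
  rewrite -big_filter -[RHS]big_filter; apply: perm_big.
  rewrite uniq_perm ?filter_uniq ?uniq_dom// => v; rewrite !mem_filter.
  by case: (boolP (v \in dom d)) => //= /ds ->.
by rewrite !big1// => v /coeff_outdom ->; rewrite scale0r.
Qed.

Lemma flift_linear F : linear (flift F).
Proof.
move=> a x y; pose s := undup (dom x ++ dom y ++ dom (a *: x + y)).
have s_uniq : uniq s by rewrite undup_uniq.
rewrite (@flift_widen F x s)// ?(@flift_widen F y s)// ?(@flift_widen F _ s)//.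
- rewrite scaler_sumr -big_split; apply: eq_bigr => v _ /=.
  by rewrite coeffD coeffZ scalerDl scalerA.
- by move=> v vx; rewrite mem_undup !mem_cat vx !orbT.
- by move=> v vx; rewrite mem_undup !mem_cat vx !orbT.
- by move=> v vx; rewrite mem_undup !mem_cat vx.
Qed.

Lemma fliftU F v : flift F << v >> = F v.
Proof. by rewrite /flift domU1 big_seq1 coeffU eqxx mulr1 scale1r. Qed.

Lemma flift_comb a F G d :
  flift (fun v => a *: F v + G v) d = a *: flift F d + flift G d.
Proof.
rewrite /flift scaler_sumr -big_split; apply: eq_bigr => v _ /=.
by rewrite scalerDr !scalerA mulrC.
Qed.

End FreeLift.

Section Lifting.
Variables (K : numFieldType) (g : simpleLie K) (l n : nat).
Variables (X : pointedLine K n) (lam : 'I_n -> weight g).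
Variables (H : forall i, hwModule l (lam i)) (W : lmodType K).
Implicit Type F : (forall i, H i) -> W.

Definition is_multilinear F : Prop := forall v i a (x y : H i),
  F (dfwith v i (a *: x + y)) = a *: F (dfwith v i x) + F (dfwith v i y).

Definition is_gauge_invariant F : Prop :=
  forall (Y : g) f (s : 'I_n -> series K) v,
  regular_away X f -> (forall i, is_expansion X i f (s i)) ->
  \sum_(i < n) F (dfwith v i (act (loop Y (s i)) (v i))) = 0.

Definition coinv_lift F (q : coinvariants X H) : W :=
  flift F (lift_repr (lift_repr q : tensor H)).

Lemma linear_vanish (V : lmodType K) (S : set V) (f : V -> W) : linear f ->
  (forall s, S s -> f s = 0) -> forall x, x \in span_pred S -> f x = 0.
Proof.
move=> f_lin fS x /asboolP/(_ [set y | f y = 0]); apply=> //; split => /=.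
  by have := f_lin (- 1) 0 0; rewrite scaler0 addr0 scaleN1r addNr.
by move=> a y z fy fz; rewrite f_lin fy fz scaler0 addr0.
Qed.

Lemma linear_descends (V : lmodType K) (S : set V) (f : V -> W) : linear f ->
  (forall s, S s -> f s = 0) -> forall x, f (lift_repr (proj S x)) = f x.
Proof.
move=> f_lin fS x; have /projP/(linear_vanish f_lin fS) := lift_reprK (proj S x).
set y := lift_repr _ => fyx.
by rewrite -[y](subrK x) -[y - x]scale1r f_lin fyx scaler0 add0r.
Qed.

Lemma proj_linear (V : lmodType K) (S : set V) : linear (proj S).
Proof. by move=> a x y; rewrite projD -[X in X + _]quot_scaleE. Qed.

Lemma lift_linear (V : lmodType K) (S : set V) (f : V -> W) : linear f ->
  (forall s, S s -> f s = 0) -> linear (fun q : quot S => f (lift_repr q)).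
Proof.
move=> f_lin fS a p q; rewrite -[p]lift_reprK -[q]lift_reprK -proj_linear.
by rewrite !linear_descends// f_lin.
Qed.

Variable F : (forall i, H i) -> W.
Hypotheses (Fmulti : is_multilinear F) (Fgauge : is_gauge_invariant F).

Let F1 (r : tensor H) := flift F (lift_repr r).

Let flift_rel r : multilinear_rel r -> flift F r = 0.
Proof.
move=> [v [i [a [x [y ->]]]]].
have fD u z : flift F (u + z) = flift F u + flift F z.
  by have := flift_linear F 1 u z; rewrite !scale1r.
have fZ c u : flift F (c *: u) = c *: flift F u.
  by have := flift_linear F c u 0; rewrite /flift !dom0 !big_nil !addr0.
rewrite fD -scaleN1r !(fD, fZ) !fliftU Fmulti scaleN1r.
by rewrite subrr.
Qed.

Let F1_linear : linear F1.
Proof. exact: lift_linear (flift_linear F) flift_rel. Qed.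

Let F1_ptens v : F1 (ptens v) = F v.
Proof. by rewrite /F1 (linear_descends (flift_linear F) flift_rel) fliftU. Qed.

Let F1_gauge r : gauge_image X r -> F1 r = 0.
Proof.
move=> [Y [f [s [v [fX sf ->]]]]].
rewrite -[RHS](Fgauge Y v fX sf) /gauge_act.
have F10 : F1 0 = 0.
  by have := F1_linear (- 1) 0 0; rewrite scaler0 addr0 scaleN1r addNr.
have F1D x y : F1 (x + y) = F1 x + F1 y.
  by have := F1_linear 1 x y; rewrite !scale1r.
rewrite (big_morph F1 F1D F10); apply: eq_bigr => i _; exact: F1_ptens.
Qed.

Lemma coinv_lift_linear : linear (coinv_lift F).
Proof. exact: lift_linear F1_linear F1_gauge. Qed.

Lemma coinv_liftE v : coinv_lift F (coinv_class X v) = F v.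
Proof.
by rewrite -F1_ptens; apply: (linear_descends F1_linear F1_gauge).
Qed.

End Lifting.

Section Bilinear.
Variables (K : fieldType) (U V W : lmodType K) (b : U -> V -> W).

Definition is_bilinear : Prop :=
  (forall v, linear (b^~ v)) /\ (forall u, linear (b u)).

Definition is_nonzero : Prop := exists u v, b u v <> 0.

Definition nondegenerate_pairing : Prop :=
  (forall u, (forall v, b u v = 0) -> u = 0) /\
  (forall v, (forall u, b u v = 0) -> v = 0).

End Bilinear.

Section Embedding.
Variables (K : numFieldType) (g1 g2 g : simpleLie K).
Variable phi : {linear (g1 * g2)%type -> g}.

Definition is_lie_embedding : Prop :=
  injective phi /\ forall x y,
    phi (lie x.1 y.1, lie x.2 y.2) = lie (phi x) (phi y).

Definition phi1 (x : g1) : g := phi (x, 0).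
Definition phi2 (y : g2) : g := phi (0, y).

Lemma phi1_linear : linear phi1.
Proof.
move=> a x y; rewrite /phi1 -linearP; congr (phi _).
by apply/pair_equal_spec; split => //=; rewrite scaler0 addr0.
Qed.

Lemma phi2_linear : linear phi2.
Proof.
move=> a x y; rewrite /phi2 -linearP; congr (phi _).
by apply/pair_equal_spec; split => //=; rewrite scaler0 addr0.
Qed.

HB.instance Definition _ := GRing.isLinear.Build K g1 g *:%R phi1 phi1_linear.
HB.instance Definition _ := GRing.isLinear.Build K g2 g *:%R phi2 phi2_linear.

Definition has_dynkin_index (l1 l2 : nat) : Prop :=
  (forall x y, form (phi1 x) (phi1 y) = l1%:R * form x y) /\
  (forall x y, form (phi2 x) (phi2 y) = l2%:R * form x y).

Definition preserves_cartan : Prop :=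
  forall x y, x \in cartan g1 -> y \in cartan g2 -> phi (x, y) \in cartan g.

(* phi(mu), as an element of the Cartan subalgebra of g. *)
Definition phi_cartan (mu : cartan_elt g2) : cartan_elt g :=
  vsproj (cartan g) (phi2 (vsval mu)).

Variables l1 l2 : nat.

Definition hat_phi1 (x : affine g1) : affine g := (lmap phi1 x.1, l1%:R * x.2).
Definition hat_phi2 (y : affine g2) : affine g := (lmap phi2 y.1, l2%:R * y.2).

(* Elements of Hom(H1 (x) H2, H), seen as bilinear maps. *)
Definition is_branching lam gam Lam (H1 : hwModule l1 lam) (H2 : hwModule l2 gam)
    (H : hwModule 1%N Lam) (psi : H1 -> H2 -> H) : Prop :=
  [/\ is_bilinear psi,
      forall x v w, psi (act x v) w = act (hat_phi1 x) (psi v w) &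
      forall y v w, psi v (act y w) = act (hat_phi2 y) (psi v w)].

Definition multiplicity_one lam gam Lam (H1 : hwModule l1 lam)
    (H2 : hwModule l2 gam) (H : hwModule 1%N Lam) : Prop :=
  exists psi : H1 -> H2 -> H, [/\ is_branching psi, is_nonzero psi &
    forall psi' : H1 -> H2 -> H, is_branching psi' ->
      exists c : K, forall v w, psi' v w = c *: psi v w].

Section RankLevel.
Variables (n : nat) (X : pointedLine K n).
Variables (lam : 'I_n -> weight g1) (gam : 'I_n -> weight g2).
Variable Lam : 'I_n -> weight g.
Variable H1 : forall i, hwModule l1 (lam i).
Variable H2 : forall i, hwModule l2 (gam i).
Variable H : forall i, hwModule 1%N (Lam i).

(* B is induced on coinvariants by the tensor product of nonzero intertwiners
   psi_i; when these are unique up to scalars, so is B. *)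
Definition is_rank_level_map
    (B : coinvariants X H1 -> coinvariants X H2 -> coinvariants X H) : Prop :=
  is_bilinear B /\
  exists psi : forall i, H1 i -> H2 i -> H i,
    (forall i, is_branching (psi i) /\ is_nonzero (psi i)) /\
    forall v w, B (coinv_class X v) (coinv_class X w) =
                coinv_class X (fun i => psi i (v i) (w i)).

End RankLevel.

End Embedding.

Section RankLevelExists.
Variables (K : numFieldType) (g1 g2 g : simpleLie K).
Variables (phi : {linear (g1 * g2)%type -> g}) (l1 l2 n : nat).
Variable X : pointedLine K n.
Variables (lam : 'I_n -> weight g1) (gam : 'I_n -> weight g2).
Variable Lam : 'I_n -> weight g.
Variable H1 : forall i, hwModule l1 (lam i).
Variable H2 : forall i, hwModule l2 (gam i).
Variable H : forall i, hwModule 1%N (Lam i).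
Variable psi : forall i, H1 i -> H2 i -> H i.
Hypothesis psiP : forall i, is_branching phi (@psi i).

Let F v w : coinvariants X H := coinv_class X (fun i => psi (v i) (w i)).

Lemma coinv_class_multi : is_multilinear (@coinv_class K g 1%N n X Lam H).
Proof.
move=> v i a x y; rewrite /coinv_class -proj_linear; congr proj.
rewrite /ptens -proj_linear; apply/projP; apply/asboolP => W _; apply.
by exists v, i, a, x, y.
Qed.

Lemma coinv_class_gauge : is_gauge_invariant X (@coinv_class K g 1%N n X Lam H).
Proof.
move=> Y f s v fX sf.
have proj0 (V : lmodType K) (S : set V) : proj S 0 = 0.
  have := @proj_linear K V S (- 1) 0 0.
  by rewrite scaler0 addr0 scaleN1r addNr.
rewrite /coinv_class -(big_morph _ (@projD _ _ _) (proj0 _ _)).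
rewrite -[RHS](proj0 _ (gauge_image X (H:=H))); apply/projP; rewrite subr0.
by apply/asboolP => W _; apply; exists Y, f, s, v.
Qed.

Let psil (i : 'I_n) (v : forall i, H1 i) (w : forall i, H2 i) (x : H1 i) :
  (fun j => psi (dfwith v i x j) (w j)) =
  dfwith (T := fun j => H j) (fun j => psi (v j) (w j)) i (psi x (w i)).
Proof.
apply: functional_extensionality_dep => j.
by case: dfwithP => [|k ik]; [rewrite dfwithin|rewrite dfwithout].
Qed.

Let psir (i : 'I_n) (v : forall i, H1 i) (w : forall i, H2 i) (x : H2 i) :
  (fun j => psi (v j) (dfwith w i x j)) =
  dfwith (T := fun j => H j) (fun j => psi (v j) (w j)) i (psi (v i) x).
Proof.
apply: functional_extensionality_dep => j.
by case: dfwithP => [|k ik]; [rewrite dfwithin|rewrite dfwithout].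
Qed.

Let Fl_multi w : is_multilinear (F^~ w).
Proof.
move=> v i a x y; rewrite /F !psil.
by have [[-> _] _ _] := psiP i; exact: coinv_class_multi.
Qed.

Let Fr_multi v : is_multilinear (F v).
Proof.
move=> w i a x y; rewrite /F !psir.
by have [[_ ->] _ _] := psiP i; exact: coinv_class_multi.
Qed.

Let hat1E Y s : hat_phi1 phi l1 (loop Y s) = loop (phi1 phi Y) s.
Proof.
congr pair; last by rewrite /= mulr0.
by apply/laurentP => k /=; rewrite linearZ.
Qed.

Let hat2E Y s : hat_phi2 phi l2 (loop Y s) = loop (phi2 phi Y) s.
Proof.
congr pair; last by rewrite /= mulr0.
by apply/laurentP => k /=; rewrite linearZ.
Qed.

Let Fl_gauge w : is_gauge_invariant X (F^~ w).
Proof.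
move=> Y f s v fX sf.
rewrite -[RHS](coinv_class_gauge (phi1 phi Y) (fun i => psi (v i) (w i)) fX sf).
apply: eq_bigr => i _; rewrite /F psil; have [_ -> _] := psiP i.
by rewrite hat1E.
Qed.

Let Fr_gauge v : is_gauge_invariant X (F v).
Proof.
move=> Y f s w fX sf.
rewrite -[RHS](coinv_class_gauge (phi2 phi Y) (fun i => psi (v i) (w i)) fX sf).
apply: eq_bigr => i _; rewrite /F psir; have [_ _ ->] := psiP i.
by rewrite hat2E.
Qed.

(* A tensor product of intertwiners always descends to coinvariants. *)
Lemma rank_level_map_exists : (forall i, is_nonzero (@psi i)) ->
  exists B : coinvariants X H1 -> coinvariants X H2 -> coinvariants X H,
    is_rank_level_map phi B.
Proof.
move=> psi_neq0.
pose Fq (q : coinvariants X H2) v := coinv_lift (F v) q.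
have Fq_multi q : is_multilinear (Fq q).
  move=> v i a x y; rewrite /Fq -[RHS]flift_comb /coinv_lift; congr flift.
  by apply: functional_extensionality_dep => w; exact: Fl_multi.
have flift0 d : flift (fun _ : forall i, H2 i => 0 : coinvariants X H) d = 0.
  by rewrite /flift big1// => v _; rewrite scaler0.
have fliftD (G1 G2 : (forall i, H2 i) -> coinvariants X H) d :
    flift (fun w => G1 w + G2 w) d = flift G1 d + flift G2 d.
  rewrite -[flift G1 d]scale1r -flift_comb; congr flift.
  by apply: functional_extensionality_dep => w; rewrite scale1r.
have Fq_gauge q : is_gauge_invariant X (Fq q).
  move=> Y f s v fX sf; rewrite /Fq /coinv_lift; set d := lift_repr _.
  rewrite -[RHS](flift0 d).
  transitivity (flift (fun w =>
      \sum_(i < n) F (dfwith v i (act (loop Y (s i)) (v i))) w) d); last first.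
    congr flift; apply: functional_extensionality_dep => w.
    exact: (Fl_gauge w Y v fX sf).
  rewrite /flift exchange_big/=; apply: eq_bigr => w _.
  by rewrite scaler_sumr.
exists (fun p q => coinv_lift (Fq q) p); split; first split.
- by move=> q; exact: (coinv_lift_linear (Fq_multi q) (Fq_gauge q)).
- move=> p a q r; rewrite -[RHS]flift_comb; congr flift.
  apply: functional_extensionality_dep => v.
  exact: (coinv_lift_linear (Fr_multi v) (Fr_gauge v)).
exists psi; split=> [i|v w]; first by split; [exact: psiP|exact: psi_neq0].
rewrite (coinv_liftE (Fq_multi _) (Fq_gauge _)).
exact: (coinv_liftE (Fr_multi v) (Fr_gauge v)).
Qed.

End RankLevelExists.

(* Main.v *)
(* Fix root vectors X_a and multiply X_a (x) f by the rational function
   m_a(z) = prod_j (z - p_j)^(a(mu_j)). Since sum_j mu_j = 0, this m_a and its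
   inverse are regular away from the marked points, and the expansion of m_a at
   the i-th point is xi_i^(a(mu_i)) times a unit u_a. The single shift by mu_i
   accounts for the power of xi_i, and the unit is inner: writing
   z - p_j = c_j xi_i^o exp(q_j) at the i-th point, multiplication by u_a is
   conjugation by exp(sum_j mu_j (x) q_j), which converges on a highest weight
   module, followed by torus elements taking care of the constants c_j.
   Composing with the isomorphisms Theta_i gives maps T_i : H_i -> H'_i under
   which the coinvariants of the two sides correspond. Only root vectors have to
   be checked, because they generate the Lie algebra and residues of exact
   differentials vanish; in particular no residue theorem is needed.

   The shift of phi(mu_i) restricts to the shift of mu_i on g_2 and to the
   identity on g_1, so it carries intertwiners to intertwiners, and multiplicity
   one identifies the two rank-level duality maps up to a nonzero scalar. *)
From HB Require Import structures.
From mathcomp Require Import all_boot all_order all_algebra zify ring.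
From mathcomp Require Import mathcomp_extra boolp classical_sets functions.
From mathcomp Require Import reals complex freeg.
Require Import Defs.

Set Implicit Arguments.
Unset Strict Implicit.
Unset Printing Implicit Defensive.

Import Order.TTheory GRing.Theory Num.Theory.
Local Open Scope ring_scope.

(** * Formal Laurent series *)

Section SeriesOrder.
Variable K : numFieldType.
Implicit Types (x y z : series K) (N M : int).

Definition order_ge N x := forall i : int, i < N -> x i = 0.

Lemma order_ge_exists x : exists N, order_ge N x.
Proof. exact: laurent_bound. Qed.

Lemma order_geW N M x : M <= N -> order_ge N x -> order_ge M x.
Proof. by move=> MN xN i iM; apply: (xN); exact: lt_le_trans iM MN. Qed.

Lemma scoefM x y N M (k : int) (m : nat) : order_ge N x -> order_ge M y ->
  k - M < N + m%:Z -> (x * y) k = \sum_(j < m) x (N + j%:Z) * y (k - (N + j%:Z)).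
Proof. by move=> xN yM kM; exact: (smulE xN yM (lexx N) kM). Qed.

Lemma order_geM N M x y : order_ge N x -> order_ge M y -> order_ge (N + M) (x * y).
Proof.
move=> xN yM i iNM; rewrite (@scoefM x y N M i 0)// ?big_ord0//; lia.
Qed.

Lemma order_geD N x y : order_ge N x -> order_ge N y -> order_ge N (x + y).
Proof. by move=> xN yN i iN; rewrite seriesD xN// yN// addr0. Qed.

Lemma order_geZ N a x : order_ge N x -> order_ge N (a *: x).
Proof. by move=> xN i iN; rewrite seriesZ xN// mulr0. Qed.

Lemma seriesB x y k : (x - y) k = x k - y k.
Proof. by []. Qed.

Lemma order_ge0 N : order_ge N 0.
Proof. by []. Qed.

Lemma order_geB N x y : order_ge N x -> order_ge N y -> order_ge N (x - y).
Proof. by move=> xN yN; rewrite -scaleN1r; exact: order_geD (order_geZ _ _). Qed.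

Lemma order_ge_sum N (I : Type) (r : seq I) (P : pred I) (F : I -> series K) :
  (forall i, P i -> order_ge N (F i)) -> order_ge N (\sum_(i <- r | P i) F i).
Proof.
by move=> FN; elim/big_rec: _ => // i x Pi; apply: order_geD; exact: FN.
Qed.

Lemma order_ge_xi (k : int) : order_ge k (xi K k).
Proof. by move=> i ik /=; rewrite lt_eqF. Qed.

Lemma order_ge1 : order_ge 0 1.
Proof. exact: order_ge_xi. Qed.

Lemma order_geX N x n : order_ge N x -> order_ge (N * n%:Z) (x ^+ n).
Proof.
move=> xN; elim: n => [|n IHn]; first by rewrite mulr0 expr0; exact: order_ge1.
by rewrite exprS; apply: order_geW (order_geM xN IHn); lia.
Qed.

Lemma series_eq x y : (forall N, order_ge N (x - y)) -> x = y.
Proof.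
move=> xy; apply/eqP; rewrite -subr_eq0; apply/eqP/laurentP => k.
by rewrite (xy (k + 1))//; lia.
Qed.

Lemma coef_xiM (k n : int) x : (xi K k * x) n = x (n - k).
Proof.
have [N xN] := order_ge_exists x.
have m_gt : n - N < k + (absz (n - N - k)%R).+1%:Z by lia.
rewrite (scoefM (@order_ge_xi k) xN m_gt) big_ord_recl big1 /= ?addr0 ?eqxx ?mul1r//.
by move=> i _; rewrite [_ == k](_ : _ = false) ?mul0r// /bump; lia.
Qed.

Lemma xiM (k n : int) : xi K k * xi K n = xi K (k + n).
Proof. by apply/laurentP => i; rewrite coef_xiM /= subr_eq addrC. Qed.

Lemma xi0 : xi K 0 = 1. Proof. by []. Qed.

Lemma scoef1 (n : int) : (1 : series K) n = (n == 0)%:R.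
Proof. by []. Qed.

Lemma sderivE x (n : int) : sderiv x n = (n + 1)%:~R * x (n + 1).
Proof. by []. Qed.

Lemma sderiv_linear : linear (@sderiv K).
Proof.
move=> a x y; apply/laurentP => k.
by rewrite seriesD seriesZ !sderivE seriesD seriesZ mulrDr mulrCA.
Qed.

HB.instance Definition _ := GRing.isLinear.Build K (series K) (series K) *:%R
  (@sderiv K) sderiv_linear.

Lemma order_ge_deriv N x : order_ge N x -> order_ge (N - 1) (sderiv x).
Proof. by move=> xN i iN; rewrite sderivE xN ?mulr0//; lia. Qed.

Lemma res_sderiv x : res (sderiv x) = 0.
Proof. by rewrite /res sderivE mul0r. Qed.

Lemma sderivM x y : sderiv (x * y) = sderiv x * y + x * sderiv y.
Proof.
apply/laurentP => k.
have [N xN] := order_ge_exists x; have [M yM] := order_ge_exists y.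
set m := (absz (k + 1 - M - N)%R).+1.
rewrite seriesD sderivE (scoefM (m := m) xN yM); last by lia.
rewrite (scoefM (m := m) (order_ge_deriv xN) yM); last by lia.
rewrite (scoefM (m := m) xN (order_ge_deriv yM)); last by lia.
rewrite mulr_sumr -big_split /=; apply: eq_bigr => j _.
have -> : k - (N - 1 + j%:Z) = k + 1 - (N + j%:Z) by lia.
have -> : N - 1 + j%:Z + 1 = N + j%:Z by lia.
have -> : k - (N + j%:Z) + 1 = k + 1 - (N + j%:Z) by lia.
move: (x _) (y _) => a b; rewrite mulrA.
have -> : (k + 1)%:~R = (N + j%:Z)%:~R + (k + 1 - (N + j%:Z))%:~R :> K.
  by rewrite -intrD; congr (_%:~R); lia.
ring.
Qed.

Lemma sderiv1 : sderiv (1 : series K) = 0.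
Proof.
apply/laurentP => k; rewrite sderivE scoef1.
by have [->|k1] := eqVneq (k + 1) 0; rewrite ?mul0r// mulr0.
Qed.

Lemma sderivX x n : sderiv (x ^+ n.+1) = n.+1%:R *: (sderiv x * x ^+ n).
Proof.
elim: n => [|n IHn]; first by rewrite expr1 expr0 mulr1 scale1r.
rewrite exprS sderivM {}IHn -scalerAr mulrCA -exprS -[X in X + _]scale1r.
by rewrite -scalerDl addrC natr1.
Qed.

Lemma scoef_sum (I : Type) (r : seq I) (P : pred I) (F : I -> series K) (k : int) :
  (\sum_(i <- r | P i) F i) k = \sum_(i <- r | P i) F i k.
Proof. by apply: (big_morph (fun x : series K => x k)). Qed.

(** The difference d satisfies d' = r d. If d has order at least n + 1, so has r d, and the
    coefficient of xi^n gives (n + 1) d_(n+1) = 0. In characteristic 0 the order of d therefore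
    grows without bound. *)
Lemma ode_unique (r x y : series K) : order_ge 0 r -> order_ge 0 x -> order_ge 0 y ->
  sderiv x = r * x -> sderiv y = r * y -> x 0 = y 0 -> x = y.
Proof.
move=> r0 x0 y0 xr yr xy0; apply: series_eq => N.
have ord (n : nat) : order_ge n.+1%:Z (x - y).
  elim: n => [|n IHn] i iN.
    have [i0|i0] := ltP i 0; first by rewrite (order_geB x0 y0 i0).
    have -> : i = 0 by lia.
    by rewrite seriesB xy0 subrr.
  have [i0|i0] := ltP i n.+1%:Z; first exact: IHn.
  have -> : i = n%:Z + 1 by lia.
  have := order_geM r0 IHn; rewrite add0r => /(_ n%:Z (ltnSn n)).
  have -> : r * (x - y) = sderiv (x - y) by rewrite mulrBr [RHS]raddfB -xr -yr.
  rewrite sderivE => /eqP; rewrite mulf_eq0 intr_eq0 => /orP[|/eqP//].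
  by move=> /eqP; lia.
by apply: order_geW (ord `|N|%N); lia.
Qed.

(** The coefficient of xi^m stops at j = m because q^j has order at least j as soon as q has
    positive order. *)
Lemma powser_subproof (a : nat -> K) (q : series K) :
  (fun n : int => if n is Posz m then \sum_(j < m.+1) a j * (q ^+ j) n else 0 : K^o)
    \in @bounded_below K K^o.
Proof. by apply/asboolP; exists 0; case. Qed.

(* \sum_j a j *: q ^+ j, meaningful when q has positive order. *)
Definition powser a q : series K := Laurent (powser_subproof a q).

Lemma powser_trunc a q (J : nat) : order_ge 1 q ->
  order_ge J (powser a q - \sum_(j < J) a j *: q ^+ j).
Proof.
move=> q1 i iJ; rewrite seriesB scoef_sum.
have qj (j : nat) : i < j%:Z -> (q ^+ j) i = 0.
  by move=> ij; apply: (order_geX (n := j) q1); lia.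
case: i iJ qj => [m|m] mJ qj /=.
  have -> : \sum_(j < J) (a j *: q ^+ j) m = \sum_(j < m.+1) a j * (q ^+ j) m.
    rewrite -(big_mkord xpredT (fun j => a j * (q ^+ j) m)).
    rewrite -(big_mkord xpredT (fun j => (a j *: q ^+ j) m)).
    rewrite (@big_cat_nat _ _ _ m.+1)//= [X in _ + X]big1_seq ?addr0//.
    by move=> j; rewrite mem_index_iota => /andP[_ /andP[mj _]]; rewrite -[LHS]/(a j * (q ^+ j) m) qj ?mulr0.
  by rewrite subrr.
by rewrite big1 ?subrr// => j _; rewrite -[LHS]/(a j * (q ^+ j) (Negz m)) qj ?mulr0.
Qed.

Definition sexp := powser (fun j => j`!%:R^-1).

Lemma powser_ge0 a q : order_ge 0 (powser a q).
Proof. by case. Qed.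

Lemma powser_coef0 a q : powser a q 0 = a 0.
Proof. by rewrite /= big_ord1 expr0 scoef1 mulr1. Qed.

Lemma sexp0 : sexp 0 = 1.
Proof.
apply: series_eq => N; have := @powser_trunc (fun j => j`!%:R^-1) 0 (`|N|%N).+1 (@order_ge0 1).
rewrite big_ord_recl expr0 fact0 invr1 scale1r big1 ?addr0; last first.
  by move=> i _; rewrite expr0n scaler0.
by apply: order_geW; lia.
Qed.

(** For partial sums the identity T_(J+1)' = q' T_J is exact, and the remainders contribute only in
    order at least J, with J arbitrary. *)
Lemma sexp_deriv q : order_ge 1 q -> sderiv (sexp q) = sderiv q * sexp q.
Proof.
move=> q1; apply: series_eq => N; pose J := `|N|%N; pose a (j : nat) : K := j`!%:R^-1.
pose T J := \sum_(j < J) a j *: q ^+ j.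
have dT : sderiv (T J.+1) = sderiv q * T J.
  rewrite /T linear_sum big_ord_recl /= expr0.
  rewrite linearZ /= -[X in a 0 *: X]/(sderiv 1) sderiv1 scaler0 add0r mulr_sumr; apply: eq_bigr => i _; rewrite linearZ /= sderivX.
  rewrite scalerA -scalerAr /a /bump /= add1n factS natrM invfM mulrAC.
  by rewrite mulVf ?mul1r// pnatr_eq0.
have -> : sderiv (sexp q) - sderiv q * sexp q =
    sderiv (sexp q - T J.+1) - sderiv q * (sexp q - T J).
  rewrite [sderiv (_ - _)]raddfB /= dT mulrBr opprB addrA; congr (_ - _).
  by rewrite subrK.
have q'0 := order_ge_deriv q1.
apply: (@order_geW J%:Z); first by rewrite /J; lia.
apply: order_geB.
  by apply: order_geW (order_ge_deriv (powser_trunc _ q1)); lia.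
by apply: order_geW (order_geM q'0 (powser_trunc _ q1)); lia.
Qed.

(** Both sides have constant coefficient 1 and solve x' = (p + q)' x, so [ode_unique] applies. *)
Lemma sexpD p q : order_ge 1 p -> order_ge 1 q -> sexp (p + q) = sexp p * sexp q.
Proof.
move=> p1 q1; have pq1 := order_geD p1 q1.
apply: (@ode_unique (sderiv (p + q))).
- exact: (order_ge_deriv pq1).
- exact: powser_ge0.
- by rewrite -[0]addr0; apply: order_geM; exact: powser_ge0.
- exact: sexp_deriv.
- rewrite sderivM !sexp_deriv// [sderiv (p + q)]raddfD mulrDl !mulrA.
  by rewrite [sexp p * sderiv q]mulrC.
- rewrite (@scoefM _ _ 0 0 0 1)//; try exact: powser_ge0.
  by rewrite big_ord1 !addr0 !powser_coef0 fact0 invr1 mulr1.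
Qed.

(** The witness is the logarithm series of w = 1 + q; its coefficient at j = 0 is 0 because 0^-1 =
    0. Both w and the exponential of p solve x' = p' x with constant coefficient 1. *)
Lemma sexp_log w : order_ge 1 (w - 1) -> exists2 p, order_ge 1 p & sexp p = w.
Proof.
move=> q1; set q := w - 1 in q1; pose l (j : nat) : K := (-1) ^+ j.+1 / j%:R.
have p1 : order_ge 1 (powser l q).
  move=> i i1; have [i0|i0] := ltP i 0; first exact: powser_ge0.
  have -> : i = 0 by lia.
  by rewrite powser_coef0 /l invr0 mulr0.
exists (powser l q) => //.
have pw : sderiv w = sderiv (powser l q) * w.
  apply: series_eq => N; pose J := `|N|%N.
  pose T := \sum_(j < J.+1) l j *: q ^+ j.
  (* A geometric sum telescopes here: T' is q' times the sum of the (-q)^j, and w = 1 - (-q). *)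
  have dT : sderiv T * w = sderiv q * (1 - (- q) ^+ J).
    have -> : sderiv T = sderiv q * \sum_(j < J) (- q) ^+ j.
      rewrite /T linear_sum big_ord_recl /= /l invr0 mulr0 scale0r raddf0 add0r.
      rewrite mulr_sumr; apply: eq_bigr => i _; rewrite linearZ /= sderivX.
      rewrite scalerA /bump /= add1n divfK ?pnatr_eq0// scalerAr; congr (_ * _).
      by rewrite -signr_odd /= negbK scaler_sign exprNn -signr_odd mulr_sign.
    rewrite -mulrA; congr (_ * _).
    have -> : w = 1 - (- q) by rewrite opprK addrC subrK.
    by rewrite mulrC -[1 - - q]opprB mulNr -subrX1 opprB.
  have -> : sderiv w - sderiv (powser l q) * w =
      sderiv q * (- q) ^+ J - sderiv (powser l q - T) * w.
    have -> : sderiv w = sderiv q.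
      by rewrite -[w](subrK 1) [LHS]raddfD -[X in _ + X]/(sderiv 1) sderiv1 addr0.
    have -> : sderiv (powser l q - T) = sderiv (powser l q) - sderiv T by exact: raddfB.
    by rewrite mulrBl dT; ring.
  have q'0 := order_ge_deriv q1.
  apply: (@order_geW J%:Z); first by rewrite /J; lia.
  apply: order_geB.
    have Nq1 : order_ge 1 (- q) by rewrite -scaleN1r; exact: order_geZ.
    by apply: order_geW (order_geM q'0 (order_geX (n := J) Nq1)); lia.
  have w0 : order_ge 0 w.
    rewrite -[w](subrK 1); apply: order_geD order_ge1.
    exact: order_geW q1.
  by apply: order_geW (order_geM (order_ge_deriv (powser_trunc l q1)) w0); lia.
apply: (@ode_unique (sderiv (powser l q))) => //.
- exact: (order_ge_deriv p1).
- exact: powser_ge0.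
- rewrite -[w](subrK 1); apply: order_geD order_ge1; exact: order_geW q1.
- exact: sexp_deriv.
- rewrite powser_coef0 fact0 invr1 -[w](subrK 1) seriesD q1// add0r.
  by rewrite scoef1.
Qed.

End SeriesOrder.

(** * Units and integer powers of Laurent series *)

Section SeriesUnit.
Local Open Scope classical_set_scope.
Variable K : fieldType.
Implicit Types x y : series K.

(** With a unit ring structure on series, the powers [x ^ k] make sense for negative [k], as the
    exponents a(mu_j) demand. Inverses are picked by choice. *)
Definition series_unit : {pred series K} := fun x => `[< exists y, y * x = 1 >].

Definition series_inv x : series K := xget x [set y | y * x = 1].

Lemma series_mulVr : {in series_unit, left_inverse 1 series_inv *%R}.
Proof.
by move=> x /asboolP xU; have [y yx] := xU; exact: (@xgetPex _ x [set y | y * x = 1] xU).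
Qed.

Lemma series_unitP x y : y * x = 1 -> series_unit x.
Proof. by move=> yx; apply/asboolP; exists y. Qed.

Lemma series_inv_out : {in [predC series_unit], series_inv =1 id}.
Proof.
move=> x /negP xU; rewrite /series_inv; case: xgetP => // y _ yx.
by case: xU; exact: series_unitP yx.
Qed.

HB.instance Definition _ := GRing.ComNzRing_hasMulInverse.Build (series K)
  series_mulVr series_unitP series_inv_out.

End SeriesUnit.

Section SeriesPowers.
Variable K : numFieldType.
Implicit Types (p x : series K) (k : int).

Lemma unit_series x y : y * x = 1 -> x \is a GRing.unit.
Proof. by move=> yx; exact: (series_unitP yx). Qed.

Lemma order_geN N x : order_ge N x -> order_ge N (- x).
Proof. by rewrite -scaleN1r; exact: order_geZ. Qed.

Lemma order_ge_mulz N x k : order_ge N x -> order_ge N (x *~ k).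
Proof. by rewrite -scaler_int; exact: order_geZ. Qed.

Lemma seriesXM x y k : x \is a GRing.unit -> y \is a GRing.unit ->
  (x * y) ^ k = x ^ k * y ^ k.
Proof. by move=> xU yU; apply: exprMz_comm => //; exact: mulrC. Qed.

Lemma sexp_unit p : order_ge 1 p -> sexp p \is a GRing.unit.
Proof.
move=> p1; apply: (@unit_series _ (sexp (- p))).
by rewrite -sexpD ?addNr ?sexp0//; exact: order_geN.
Qed.

Lemma sexpX p k : order_ge 1 p -> sexp p ^ k = sexp (p *~ k).
Proof.
move=> p1; have pU := sexp_unit p1.
elim/int_ind: k => [|k IHk|k IHk]; first by rewrite mulr0z sexp0.
  by rewrite -addn1 PoszD exprzDr// IHk mulrzDr sexpD//; exact: order_ge_mulz.
have -> : - k.+1%:Z = - k%:Z - 1 by lia.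
rewrite exprzDr// IHk mulrzBr mulr1z.
rewrite sexpD; try exact: order_ge_mulz; last exact: order_geN.
congr (_ * _); apply: (mulrI pU); rewrite exprN1 divrr// -sexpD ?subrr ?sexp0//.
exact: order_geN.
Qed.

Lemma xi_unit k : xi K k \is a GRing.unit.
Proof. by apply: (@unit_series _ (xi K (- k))); rewrite xiM addNr. Qed.

Lemma xiX (n k : int) : xi K n ^ k = xi K (n * k).
Proof.
have nU := xi_unit n.
elim/int_ind: k => [|k IHk|k IHk]; first by rewrite mulr0.
  by rewrite -addn1 PoszD exprzDr// IHk expr1z xiM; congr xi; lia.
have -> : - k.+1%:Z = - k%:Z - 1 by lia.
rewrite exprzDr// IHk; apply: (mulrI nU); rewrite exprN1 mulrCA divrr// mulr1 xiM.
by congr xi; lia.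
Qed.

(** Division by the lowest term leaves a series with constant coefficient 1, which has a logarithm.
    The three factors obtained (constant, power of [xi], exponential) are realized on modules by
    three different operators. *)
Lemma leading_term (N : int) x : order_ge N x -> x N <> 0 ->
  exists2 c : K, c != 0 & exists2 p, order_ge 1 p & x = c *: (xi K N * sexp p).
Proof.
move=> xN /eqP xN0; exists (x N) => //; set c : K := x N.
pose w := c^-1 *: (xi K (- N) * x).
have [i i1|p p1 pw] := @sexp_log _ w; last first.
  exists p => //; rewrite pw /w -scalerAr scalerA divff// scale1r mulrA xiM subrr.
  by rewrite xi0 mul1r.
rewrite seriesB scoef1 seriesZ coef_xiM opprK.
have [->|i0] := eqVneq i 0; first by rewrite add0r mulVf// subrr.
by rewrite xN ?mulr0 ?subrr//; lia.
Qed.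

Lemma leading_unit (N : int) c p : c != 0 -> order_ge 1 p ->
  c *: (xi K N * sexp p) \is a GRing.unit.
Proof. by move=> c0 p1; rewrite scaler_unit ?unitfE// unitrM xi_unit sexp_unit. Qed.

Lemma leadingX (N k : int) c p : c != 0 -> order_ge 1 p ->
  (c *: (xi K N * sexp p)) ^ k = c ^ k *: (xi K (N * k) * sexp (p *~ k)).
Proof.
move=> c0 p1; have [xU pU] := (xi_unit N, sexp_unit p1).
rewrite -xiX -sexpX// -seriesXM//; set y := _ * _.
have yU : y \is a GRing.unit by rewrite unitrM xU.
have cU : c%:A \is a @GRing.unit (series K) by apply: (rmorph_unit (in_alg (series K))); rewrite unitfE.
rewrite -mulr_algl seriesXM//.
rewrite -[RHS]mulr_algl; congr (_ * _); apply/esym.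
by apply: (rmorphXz (in_alg (series K)) k); rewrite unitfE.
Qed.

End SeriesPowers.

(** * Functional calculus for diagonalizable and locally nilpotent operators *)

Section DiagonalizableCalculus.
Local Open Scope classical_set_scope.
Variable K : fieldType.
Implicit Types (V W : lmodType K) (chi : K -> K).

(** Each vector is paired with its eigenvalue. Repeated eigenvalues and zero vectors are allowed, so
    that decompositions can be concatenated and mapped freely. *)
Definition eigen_seq V (N : V -> V) (s : seq (K * V)) :=
  forall p, p \in s -> N p.2 = p.1 *: p.2.

Definition eigen_sum V (N : V -> V) (v : V) (s : seq (K * V)) :=
  eigen_seq N s /\ v = \sum_(p <- s) p.2.

Definition diagonalizable_op V (N : V -> V) := forall v, exists s, eigen_sum N v s.

Lemma eigen_seq_cat V (N : V -> V) s t :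
  eigen_seq N s -> eigen_seq N t -> eigen_seq N (s ++ t).
Proof. by move=> sN tN p; rewrite mem_cat => /orP[/sN|/tN]. Qed.

Lemma eigen_seq_map V W (N : V -> V) (M : W -> W) (f : K * V -> K * W) s :
  (forall p, N p.2 = p.1 *: p.2 -> M (f p).2 = (f p).1 *: (f p).2) ->
  eigen_seq N s -> eigen_seq M (map f s).
Proof. by move=> fNM sN p /mapP[q /sN /fNM fq ->]. Qed.

(* Applying N - c to the relation, for the eigenvalue c of its first term,
   shortens it; the induction uses (chi x - chi c) / (x - c) in place of chi. *)
Lemma eigen_sum0 V (N : {linear V -> V}) chi s :
  eigen_sum N 0 s -> \sum_(p <- s) chi p.1 *: p.2 = 0.
Proof.
have [n] := ubnP (size s); elim: n s chi => // n IHn [|[c v] s] chi /=.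
  by rewrite big_nil.
rewrite ltnS => sn [sN s0].
have s'N : eigen_seq N s by move=> p ps; apply: sN; rewrite inE ps orbT.
have cv : N v = c *: v by apply: (sN (c, v)); rewrite mem_head.
pose f (p : K * V) := (p.1, (p.1 - c) *: p.2).
pose chi' x := (chi x - chi c) / (x - c).
have /(IHn _ chi') : eigen_sum N 0 (map f s).
  split; first by apply: eigen_seq_map s'N => p pN; rewrite /= linearZ /= pN !scalerA mulrC.
  have : N 0 - c *: 0 = 0 by rewrite linear0 scaler0 subr0.
  rewrite {1 2}s0 linear_sum scaler_sumr -sumrB big_cons /= cv subrr add0r => e.
  by rewrite -[LHS]e big_map; apply: eq_big_seq => p /s'N pN; rewrite /= pN scalerBl.
rewrite size_map big_map => /(_ sn) IH; rewrite big_cons /=.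
have {}IH : \sum_(p <- s) (chi p.1 - chi c) *: p.2 = 0.
  rewrite -[RHS]IH; apply: eq_bigr => p _; rewrite /= /chi' scalerA.
  have [->|pc] := eqVneq p.1 c; first by rewrite !subrr mul0r mul0r.
  by rewrite divfK ?subr_eq0.
transitivity (chi c *: \sum_(p <- (c, v) :: s) p.2); last by rewrite -s0 scaler0.
rewrite big_cons /= scalerDr scaler_sumr; congr (_ + _).
apply/eqP; rewrite -subr_eq0 -sumrB -{2}IH; apply/eqP.
by apply: eq_bigr => p _; rewrite scalerBl.
Qed.

(* chi(N), acting on the c-eigenvectors of N as chi c. *)
Definition fcalc V (N : V -> V) chi (v : V) : V :=
  \sum_(p <- xget [::] [set s | eigen_sum N v s]) chi p.1 *: p.2.

(** Independence of the chosen decomposition: the difference of two decompositions of v decomposes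
    0, and [eigen_sum0] applies to it. *)
Lemma fcalcE V (N : {linear V -> V}) chi v s :
  eigen_sum N v s -> fcalc N chi v = \sum_(p <- s) chi p.1 *: p.2.
Proof.
move=> vs; rewrite /fcalc; have vt := xgetI [::] (vs : [set s | eigen_sum N v s] s).
set t := xget _ _ in vt *.
pose opp2 (p : K * V) := (p.1, - p.2).
have /(eigen_sum0 chi) : eigen_sum N 0 (t ++ map opp2 s); last first.
  rewrite big_cat big_map /=; under [X in _ + X]eq_bigr do rewrite scalerN.
  by rewrite sumrN => /eqP; rewrite subr_eq0 => /eqP.
split; last first.
  by rewrite big_cat big_map /= sumrN -vt.2 -vs.2 subrr.
apply: eigen_seq_cat vt.1 _; apply: eigen_seq_map vs.1 => p pN.
by rewrite /= linearN pN scalerN.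
Qed.

(** P sends c-eigenvectors of N to (c + k)-eigenvectors of M. This will be applied to root vectors,
    which shift the eigenvalues of a Cartan element. *)
Lemma fcalc_shift V W (N : {linear V -> V}) (M : {linear W -> W}) (P : {linear V -> W})
    (k : K) chi v : diagonalizable_op N -> (forall v, M (P v) = P (N v) + k *: P v) ->
  fcalc M chi (P v) = P (fcalc N (fun c => chi (c + k)) v).
Proof.
move=> Nd MP; have [s vs] := Nd v.
rewrite (fcalcE _ vs) (@fcalcE _ _ _ _ (map (fun p => (p.1 + k, P p.2)) s)).
  by rewrite big_map linear_sum; apply: eq_bigr => p _; rewrite linearZ.
split; last by rewrite big_map {1}vs.2 linear_sum.
apply: eigen_seq_map vs.1 => p pN.
by rewrite /= MP pN linearZ scalerDl.
Qed.

Lemma fcalc_linear V (N : {linear V -> V}) chi : diagonalizable_op N -> linear (fcalc N chi).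
Proof.
move=> Nd a u v; have [[s us] [t vt]] := (Nd u, Nd v).
rewrite (fcalcE _ us) (fcalcE _ vt).
rewrite (@fcalcE _ _ _ _ (map (fun p => (p.1, a *: p.2)) s ++ t)).
  rewrite big_cat big_map scaler_sumr; congr (_ + _); apply: eq_bigr => p _.
  by rewrite !scalerA mulrC.
split; last by rewrite big_cat big_map /= -scaler_sumr -us.2 -vt.2.
apply: eigen_seq_cat vt.1; apply: eigen_seq_map us.1 => p pN.
by rewrite linearZ /= pN !scalerA mulrC.
Qed.

Lemma fcalc1 V (N : {linear V -> V}) v : diagonalizable_op N -> fcalc N (fun=> 1) v = v.
Proof.
move=> /(_ v)[s vs]; rewrite (fcalcE _ vs) [RHS]vs.2.
by apply: eq_bigr => p _; rewrite scale1r.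
Qed.

Lemma fcalcZ V (N : {linear V -> V}) a chi v : diagonalizable_op N ->
  fcalc N (fun c => a * chi c) v = a *: fcalc N chi v.
Proof.
move=> /(_ v)[s vs]; rewrite !(fcalcE _ vs) scaler_sumr.
by apply: eq_bigr => p _; rewrite scalerA.
Qed.

Lemma fcalcM V (N : {linear V -> V}) chi chi' v : diagonalizable_op N ->
  fcalc N chi (fcalc N chi' v) = fcalc N (fun c => chi c * chi' c) v.
Proof.
move=> /(_ v)[s vs].
rewrite (fcalcE chi' vs) (fcalcE (fun c => chi c * chi' c) vs).
rewrite (@fcalcE _ _ _ _ (map (fun p => (p.1, chi' p.1 *: p.2)) s)).
  by rewrite big_map; apply: eq_bigr => p _; rewrite scalerA.
split; last by rewrite big_map.
by apply: eigen_seq_map vs.1 => p pN; rewrite linearZ /= pN !scalerA mulrC.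
Qed.

Lemma fcalc_comm V W (N : {linear V -> V}) (M : {linear W -> W}) (P : {linear V -> W})
    chi v : diagonalizable_op N -> (forall v, M (P v) = P (N v)) ->
  fcalc M chi (P v) = P (fcalc N chi v).
Proof.
move=> Nd MP; rewrite (fcalc_shift (k := 0) _ _ Nd) => [|u]; last by rewrite scale0r addr0.
by congr (P (fcalc _ _ _)); apply/funext => c; rewrite addr0.
Qed.

Lemma fcalcZr V (N : {linear V -> V}) chi a v : diagonalizable_op N ->
  fcalc N chi (a *: v) = a *: fcalc N chi v.
Proof. by move=> Nd; apply: (fcalc_comm (P := *:%R a)) => // u; rewrite linearZ. Qed.

Definition eigenproj V (N : V -> V) c : V -> V := fcalc N (fun x => (x == c)%:R).

Lemma fcalc_eigen V (N : {linear V -> V}) c v : diagonalizable_op N ->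
  N (eigenproj N c v) = c *: eigenproj N c v.
Proof.
move=> /(_ v)[s vs]; rewrite /eigenproj (fcalcE _ vs) linear_sum scaler_sumr.
apply: eq_big_seq => p /vs.1 pN; rewrite linearZ /= pN !scalerA.
by case: eqP => [->|_]; [rewrite mulrC|rewrite mul0r mulr0].
Qed.

Lemma fcalc_decomp V (N : {linear V -> V}) v : diagonalizable_op N ->
  exists s : seq K, v = \sum_(c <- s) eigenproj N c v.
Proof.
move=> /(_ v)[s vs]; exists (undup (map fst s)).
under eq_bigr do rewrite /eigenproj (fcalcE _ vs).
rewrite exchange_big [LHS]vs.2 /=; apply: eq_big_seq => p ps.
rewrite -scaler_suml (bigD1_seq p.1)/= ?undup_uniq ?mem_undup ?map_f//.
by rewrite eqxx big1 ?addr0 ?scale1r// => c; rewrite eq_sym => /negPf ->.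
Qed.

End DiagonalizableCalculus.

(** * Exponentials of locally nilpotent operators *)

Section NilpotentExponential.
Local Open Scope classical_set_scope.
Variable K : numFieldType.
Implicit Types V W : lmodType K.

Definition locally_nilpotent V (A : V -> V) := forall v, exists m : nat, iter m A v = 0.

Lemma iter_vanish V (A : {linear V -> V}) v (m n : nat) :
  iter m A v = 0 -> (m <= n)%N -> iter n A v = 0.
Proof.
move=> v0 /subnK <-; rewrite iterD v0.
by elim: (_ - _)%N => //= i ->; exact: linear0.
Qed.

Definition expop V (A : V -> V) v : V :=
  \sum_(j < xget 0%N [set m | iter m A v = 0]) j`!%:R^-1 *: iter j A v.

Lemma expopE V (A : {linear V -> V}) v m : iter m A v = 0 ->
  expop A v = \sum_(j < m) j`!%:R^-1 *: iter j A v.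
Proof.
move=> vm; rewrite /expop; have /= vn := xgetI 0%N (vm : [set m | iter m A v = 0] m).
set n := xget _ _ in vn *.
pose F j := j`!%:R^-1 *: iter j A v; rewrite -!(big_mkord xpredT F).
have F0 i j : iter i A v = 0 -> (i <= j)%N ->
    \sum_(0 <= l < j) F l = \sum_(0 <= l < i) F l.
  move=> vi ij; rewrite (@big_cat_nat _ _ _ i)//= [X in _ + X]big1_seq ?addr0// => l.
  rewrite mem_index_iota => /andP[_ /andP[il _]].
  by rewrite /F (iter_vanish vi il) scaler0.
by have [nm|/ltnW mn] := leqP n m; [rewrite (F0 n m)|rewrite (F0 m n)].
Qed.

Lemma iter_lin V (A : {linear V -> V}) j : linear (iter j A).
Proof. by elim: j => // j IHj a u v; rewrite !iterS IHj linearP. Qed.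

Lemma expop_linear V (A : {linear V -> V}) : locally_nilpotent A -> linear (expop A).
Proof.
move=> An a u v; have [[m um] [n vn]] := (An u, An v).
have {}um := iter_vanish um (leq_maxl m n).
have {}vn := iter_vanish vn (leq_maxr m n).
rewrite (expopE um) (expopE vn) (@expopE _ _ _ (maxn m n)); last first.
  by rewrite iter_lin um vn scaler0 addr0.
rewrite scaler_sumr -big_split; apply: eq_bigr => j _ /=.
by rewrite iter_lin scalerDr !scalerA mulrC.
Qed.

Lemma expop_comm V W (A : {linear V -> V}) (B : {linear W -> W}) (P : {linear V -> W}) v :
  locally_nilpotent A -> (forall v, B (P v) = P (A v)) ->
  expop B (P v) = P (expop A v).
Proof.
move=> An BP; have [m vm] := An v.
have iP j : iter j B (P v) = P (iter j A v) by elim: j => //= j ->.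
rewrite (expopE vm) (@expopE _ _ _ m) ?iP ?vm ?linear0// linear_sum.
by apply: eq_bigr => j _; rewrite iP linearZ.
Qed.

(** exp(A) - 1 is divisible by A, so it lowers the nilpotency index of a vector. *)
Lemma expop_sub V (A : {linear V -> V}) v m : iter m.+1 A v = 0 ->
  iter m A (expop A v - v) = 0.
Proof.
move=> vm; rewrite (expopE vm) big_ord_recl fact0 invr1 scale1r /= addrC addKr.
pose iL : {linear V -> V} := HB.pack (iter m A) (GRing.isLinear.Build _ _ _ _ _ (iter_lin A m)).
rewrite -[iter m A]/(iL : V -> V) linear_sum big1// => j _.
rewrite linearZ /= [X in _ *: X](_ : _ = 0) ?scaler0//.
rewrite -[LHS]/(iter m A (iter j.+1 A v)) -iterD; apply: iter_vanish vm _.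
by rewrite addnS ltnS leq_addr.
Qed.

(** Injectivity and surjectivity are both proved by induction on the nilpotency index of the vector,
    without forming exp(-A). *)
Lemma expop_bij V (A : {linear V -> V}) : locally_nilpotent A -> bijective (expop A).
Proof.
move=> An; have eL := expop_linear An.
have eB u v : expop A (u - v) = expop A u - expop A v.
  by rewrite addrC -scaleN1r eL scaleN1r addrC.
have inj v : expop A v = 0 -> v = 0.
  have [m] := An v; elim: m v => // m IHm v; rewrite iterSr => vm ev.
  (* A v is also killed by exp(A) and has smaller index, so it is 0; then exp(A) v is v itself. *)
  have Av : A v = 0.
    by apply: IHm => //; rewrite (expop_comm (P := A) v An)// ev linear0.
  by move: ev; rewrite (@expopE _ _ _ 1)// big_ord1 fact0 invr1 scale1r.
have surj v : exists w, expop A w = v.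
  have [m] := An v; elim: m v => [|m IHm] v vm.
    have {vm}-> : v = 0 := vm.
    by exists 0; rewrite -[X in expop A X](subrr 0) eB subrr.
  (* The error exp(A) v - v has smaller index, hence a preimage w, and v - w is then a preimage of
     v. *)
  have [w ew] := IHm _ (expop_sub vm); exists (v - w).
  by rewrite eB ew opprB addrC subrK.
have [g eg] := choice surj; exists g => // v.
by apply/eqP; rewrite -subr_eq0; apply/eqP/inj; rewrite eB eg subrr.
Qed.

End NilpotentExponential.

(** * Simple Lie algebras *)

Section Subspaces.
Local Open Scope classical_set_scope.
Variables (K : fieldType) (V : lmodType K).
Implicit Types S : set V.

Lemma subspaceD S x y : is_subspace S -> S x -> S y -> S (x + y).
Proof. by move=> [_ Slin] Sx Sy; rewrite -[x]scale1r; exact: Slin. Qed.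

Lemma subspaceZ S a x : is_subspace S -> S x -> S (a *: x).
Proof. by move=> [S0 Slin] Sx; rewrite -[_ *: _]addr0; exact: Slin. Qed.

Lemma subspaceB S x y : is_subspace S -> S x -> S y -> S (x - y).
Proof. by move=> Ssub Sx Sy; rewrite -scaleN1r; apply: subspaceD => //; exact: subspaceZ. Qed.

Lemma subspace_sum S (I : eqType) (r : seq I) (F : I -> V) : is_subspace S ->
  (forall i, i \in r -> S (F i)) -> S (\sum_(i <- r) F i).
Proof.
move=> Ssub SF; rewrite big_seq; elim/big_rec: _ => [|i x ir Sx]; first exact: Ssub.1.
by apply: subspaceD => //; exact: SF.
Qed.

Lemma diagonalizable_subspace (N : {linear V -> V}) :
  is_subspace [set v | exists s, eigen_sum N v s].
Proof.
split=> [|a u v [s [sN us]] [t [tN vt]]].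
  by exists [::]; split; rewrite ?big_nil.
exists (map (fun p => (p.1, a *: p.2)) s ++ t); split.
  apply: eigen_seq_cat tN; apply: eigen_seq_map sN => p pN.
  by rewrite linearZ /= pN !scalerA mulrC.
by rewrite big_cat big_map /= -scaler_sumr -us -vt.
Qed.

End Subspaces.

(** A [{vspace V}] inside S of maximal dimension is all of S, since any further vector of S could be
    adjoined. Simplicity is stated for such spaces, while generated subalgebras appear below as
    predicates. *)
Lemma vspace_of_subspace (K : fieldType) (V : vectType K) (S : set V) :
  is_subspace S -> exists U : {vspace V}, forall x, x \in U <-> S x.
Proof.
move=> Ssub; pose P d := `[< exists U : {vspace V}, \dim U = d /\ forall x, x \in U -> S x >].
have exP : exists d, P d.
  exists 0%N; apply/asboolP; exists 0%VS; rewrite dimv0; split=> // x.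
  by rewrite memv0 => /eqP ->; exact: Ssub.1.
have leP d : P d -> (d <= \dim {:V})%N.
  by move=> /asboolP[U [<- _]]; rewrite dimvS// subvf.
case: (ex_maxnP exP leP) => d /asboolP[U [Ud US]] dmax.
exists U => x; split=> [/US//|Sx]; apply: contrapT => xU.
suff /dmax : P (\dim (U + <[x]>)).
  rewrite -Ud leqNgt => /negP; apply; rewrite (ltn_leqif (dimv_leqif_sup (addvSl U <[x]>))).
  by apply/negP => /subvP/(_ x); rewrite memvE addvSr => /(_ isT).
apply/asboolP; exists (U + <[x]>)%VS; split=> // y /memv_addP[u uU [v /vlineP[c ->] ->]].
by apply: subspaceD => //; [exact: US|exact: subspaceZ].
Qed.

Section LieAlgebra.
Variables (K : numFieldType) (L : lieAlgType K).
Implicit Types x y z : L.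

HB.instance Definition _ x := GRing.isLinear.Build K L L *:%R (lie x) (lie_linearr x).

Lemma lieNC x y : lie x y = - lie y x.
Proof.
have lieDl u v w : lie (u + v) w = lie u w + lie v w :> L.
  by have := lie_linearl w 1 u v; rewrite !scale1r.
have /eqP := lie_alt (x + y); rewrite linearD /= !lieDl !lie_alt add0r addr0.
by rewrite addrC addr_eq0 => /eqP.
Qed.

Lemma lieZl a x y : lie (a *: x) y = a *: lie x y.
Proof. by rewrite lieNC linearZ /= -scalerN -lieNC. Qed.

Lemma lieDl x y z : lie (x + y) z = lie x z + lie y z.
Proof. by rewrite lieNC linearD /= opprD -(lieNC x) -(lieNC y). Qed.

Lemma lie_lie x y z : lie x (lie y z) = lie (lie x y) z + lie y (lie x z).
Proof.
have /eqP := lie_jacobi x y z; rewrite -addrA addr_eq0 opprD => /eqP ->.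
by rewrite addrC -lieNC (lieNC x z) linearN.
Qed.

Let e := vbasis {:L}.
Let tr (f : L -> L) : K := \sum_(i < \dim {:L}) coord e i (f e`_i).

Let trC (f h : {linear L -> L}) : tr (f \o h) = tr (h \o f).
Proof.
have E (f' h' : {linear L -> L}) : tr (f' \o h') =
    \sum_(i < \dim {:L}) \sum_j coord e j (h' e`_i) * coord e i (f' e`_j).
  apply: eq_bigr => i _ /=.
  rewrite {1}(coord_vbasis (memvf (h' e`_i))) linear_sum linear_sum.
  by apply: eq_bigr => j _; rewrite !linearZ.
rewrite !E exchange_big; apply: eq_bigr => i _; apply: eq_bigr => j _.
by rewrite mulrC.
Qed.

Lemma killingC x y : killing x y = killing y x.
Proof. exact: (trC (lie x) (lie y)). Qed.

Lemma killing_linearr x : linear (killing x : L -> K^o).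
Proof.
move=> a y z; rewrite /killing scaler_sumr -big_split; apply: eq_bigr => i _ /=.
by rewrite lieDl lieZl linearP linearP.
Qed.

(** ad [x, y] is the commutator of ad x and ad y, and the trace is cyclic. *)
Lemma killing_inv x y z : killing (lie x y) z = killing x (lie y z).
Proof.
have l w : lie (lie x y) (lie z w) =
    lie x (lie y (lie z w)) - lie y (lie x (lie z w)).
  by rewrite [X in X - _]lie_lie addrK.
have r w : lie x (lie (lie y z) w) =
    lie x (lie y (lie z w)) - lie x (lie z (lie y w)).
  by rewrite [X in lie x X - _]lie_lie linearD addrK.
rewrite /killing; under eq_bigr do rewrite l linearB.
under [RHS]eq_bigr do rewrite r linearB.
rewrite !sumrB; congr (_ - _).
exact: (trC (lie y) (lie x \o lie z)).
Qed.

End LieAlgebra.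

(** * Root decomposition, generation by root vectors, and the single shift *)

Section SimpleLie.
Local Open Scope classical_set_scope.
Variables (K : numFieldType) (g : simpleLie K).
Implicit Types (x y z : g) (a : weight g) (nu : cartan_elt g).

Lemma form_sym x y : form x y = form y x.
Proof. by have [s sE] := formP g; rewrite !sE killingC. Qed.

Lemma form_linearr x : linear (form x : g -> K^o).
Proof.
have [s sE] := formP g; move=> c y z; rewrite !sE killing_linearr.
by rewrite mulrDr [c *: (_ * _)]mulrCA.
Qed.

Lemma form_inv x y z : form (lie x y) z = form x (lie y z).
Proof. by have [s sE] := formP g; rewrite !sE killing_inv. Qed.

HB.instance Definition _ x := GRing.isLinear.Build K g K^o *:%R (form x) (form_linearr x).

(** By invariance, c form(y, z) = form(y, [x, z]) = form([y, x], z) = 0. *)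
Lemma form_eigen x y z (c : K) : c <> 0 -> lie x y = 0 -> lie x z = c *: z -> form y z = 0.
Proof.
move=> /eqP c0 xy xz; apply/eqP; rewrite -(mulrI_eq0 _ (mulfI c0)).
have <- : form y (c *: z) = c * form y z by exact: linearZ.
by rewrite -xz -form_inv lieNC xy oppr0 form_sym linear0.
Qed.

Lemma cartanC (h h' : cartan_elt g) : lie (vsval h) (vsval h') = 0.
Proof. by have [tt _ _] := cartanP g; rewrite tt ?subvsP. Qed.

Lemma ad_cartan_diagonalizable x : x \in cartan g -> diagonalizable_op (lie x).
Proof.
move=> xt v; have [_ /(_ _ xt)[e [eb ev]] _] := cartanP g.
have etb : basis_of {:g} (in_tuple e) by [].
rewrite (coord_basis etb (memvf v)).
apply: (subspace_sum (diagonalizable_subspace (lie x))) => i _.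
apply: subspaceZ; first exact: diagonalizable_subspace.
have [c xe] := ev _ (mem_nth 0 (ltn_ord i)).
exists [:: (c, e`_i)]; split; last by rewrite big_seq1.
by move=> p; rewrite inE => /eqP ->.
Qed.

(** The decomposition is refined by one element h at a time. Since ad h commutes with the other ad
    h', its eigenprojections preserve their eigenspaces. *)
Lemma joint_eigen (hs : seq g) x : {subset hs <= cartan g} ->
  exists s : seq g, x = \sum_(y <- s) y /\
    forall y, y \in s -> forall h, h \in hs -> exists c : K, lie h y = c *: y.
Proof.
elim: hs => [|h hs IHhs] ht; first by exists [:: x]; rewrite big_seq1.
have [|s [-> sP]] := IHhs; first by move=> h' h'hs; apply: ht; rewrite inE h'hs orbT.
have hC : h \in cartan g by apply: ht; rewrite mem_head.
have hd := ad_cartan_diagonalizable hC.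
elim: s sP => [|y s IHs] sP; first by exists [::].
have [|t [tE tQ]] := IHs; first by move=> y' y's; apply: sP; rewrite inE y's orbT.
have [r yE] := fcalc_decomp y hd.
exists (map (fun c => eigenproj (lie h) c y) r ++ t); split.
  by rewrite big_cons big_cat big_map /= -yE -tE.
move=> z; rewrite mem_cat => /orP[/mapP[c _ ->]|/tQ//] h'.
rewrite inE => /predU1P[->|h'hs]; first by exists c; exact: fcalc_eigen.
have [b yb] := sP y (mem_head _ _) h' h'hs.
exists b; have [tt _ _] := cartanP g.
have h'C : h' \in cartan g by apply: ht; rewrite inE h'hs orbT.
rewrite /eigenproj -(fcalc_comm (M := lie h) (P := lie h') _ _ hd) => [|v]; last first.
  by rewrite [RHS]lie_lie (tt h')// lie0l add0r.
by rewrite /= yb fcalcZr.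
Qed.

(** The root space decomposition as an induction principle. A nonzero joint eigenvector for a basis
    of t defines a functional on t; it is a root unless it is 0, and then the vector centralizes t
    and so lies in t. *)
Lemma root_decomposition (S : set g) : is_subspace S ->
  (forall x, x \in cartan g -> S x) ->
  (forall a y, is_root a -> in_root_space a y -> S y) -> forall x, S x.
Proof.
move=> Ssub St Sroot x; set t := cartan g.
have [|s [-> sP]] := @joint_eigen (vbasis t) x; first by move=> y /vbasis_mem.
apply: subspace_sum => // y /sP yP.
have [->|y0] := eqVneq y 0; first exact: Ssub.1.
have yt (h : cartan_elt g) : exists c : K, lie (vsval h) y = c *: y.
  rewrite (coord_vbasis (subvsP h)).
  elim/big_ind: _ => [|u v [c uc] [d vd]|i _]; first by exists 0; rewrite lie0l scale0r.
    by exists (c + d); rewrite lieDl uc vd scalerDl.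
  have [|c yc] := yP (vbasis t)`_i; first by rewrite mem_nth ?size_tuple.
  by exists (coord (vbasis t) i (vsval h) * c); rewrite lieZl yc scalerA.
have [c cP] := choice yt.
have clin : linear (c : cartan_elt g -> K^o).
  move=> b h h'; have : (c (b *: h + h') - (b * c h + c h')) *: y = 0.
    by rewrite scalerBl scalerDl -scalerA -!cP linearP lieDl lieZl subrr.
  by move=> /eqP; rewrite scaler_eq0 (negPf y0) orbF subr_eq0 => /eqP.
pose cL : {linear cartan_elt g -> K^o} := HB.pack c (GRing.isLinear.Build _ _ _ _ _ clin).
pose a : weight g := linfun cL.
have ya : in_root_space a y by move=> h; rewrite cP lfunE.
have [a0|/eqP a0] := eqVneq a 0; last by apply: (Sroot a) => //; split=> //; exists y => //; apply/eqP.
apply: St; have [_ _] := cartanP g; apply=> h ht.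
have := ya (vsproj t h); rewrite vsprojK// a0 => ->.
by rewrite zero_lfunE scale0r.
Qed.

(** The subalgebra generated by the root vectors is also stable under t, hence an ideal. It is not
    0, for otherwise g = t would be abelian; so it is g. *)
Lemma simple_generated (S : set g) : is_subspace S ->
  (forall x y, S x -> S y -> S (lie x y)) ->
  (forall a y, is_root a -> in_root_space a y -> S y) -> forall x, S x.
Proof.
move=> Ssub Slie Sroot.
pose closed (T : set g) := [/\ is_subspace T, forall x y, T x -> T y -> T (lie x y) &
  forall a y, is_root a -> in_root_space a y -> T y].
pose S0 x := forall T, closed T -> T x.
have S0sub : is_subspace S0.
  split=> [T [[T0 _] _ _]//|b x y xS yS T Tc].
  by have [Tsub _ _] := Tc; apply: Tsub.2; [exact: xS|exact: yS].
have S0lie x y : S0 x -> S0 y -> S0 (lie x y).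
  by move=> xS yS T Tc; have [_ + _] := Tc; apply; [exact: xS|exact: yS].
have S0root a y : is_root a -> in_root_space a y -> S0 y.
  by move=> ra ay T Tc; have [_ _] := Tc; apply; [exact: ra|exact: ay].
have S0t h x : h \in cartan g -> S0 x -> S0 (lie h x).
  (* The elements of [S0] whose bracket with h stays in [S0] form a subalgebra containing the root
     vectors, on which h acts by scalars. *)
  move=> ht /(_ (fun x => S0 x /\ S0 (lie h x))) []//; split.
  - split=> [|b u v [uS huS] [vS hvS]]; first by rewrite linear0; split; exact: S0sub.1.
    by split; rewrite ?linearP; exact: S0sub.2.
  - move=> u v [uS huS] [vS hvS]; split; first exact: S0lie.
    by rewrite lie_lie; apply: (subspaceD S0sub); exact: S0lie.
  - move=> a y ra ay; have yS := S0root _ _ ra ay; split=> //.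
    have := ay (vsproj (cartan g) h); rewrite vsprojK// => ->.
    exact: (subspaceZ _ S0sub).
have S0ideal x y : S0 y -> S0 (lie x y).
  move=> yS; move: x; apply: root_decomposition.
  - split=> [|b u v uS vS]; first by rewrite lie0l; exact: S0sub.1.
    by rewrite lieDl lieZl; exact: S0sub.2.
  - by move=> h ht; exact: S0t.
  - by move=> a u ra au; apply: S0lie => //; exact: S0root au.
have [U US] := vspace_of_subspace S0sub.
have [[u [v uv]] /(_ U) gU] := lie_simple g.
move=> x; have {gU}[|U0|UT] := gU.
- by move=> {}x y /US yS; apply/US; exact: S0ideal.
- exfalso; apply: uv; have tT : forall x, x \in cartan g.
    apply: root_decomposition => //.
    - by split=> [|b y z yt zt]; rewrite ?mem0v// memvD ?memvZ.
    - move=> a y ra ay; have : y \in U by apply/US; exact: S0root ay.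
      by rewrite U0 memv0 => /eqP ->; exact: mem0v.
  by have [tt _ _] := cartanP g; exact: tt.
have : x \in U by rewrite UT memvf.
by move=> /US; apply.
Qed.

Lemma form_root_cartan a y (h : cartan_elt g) :
  is_root a -> in_root_space a y -> form (vsval h) y = 0.
Proof.
move=> [a0 _] ya; have [h' ah'] : exists h', (a h' : K) <> 0.
  apply: contrapT => ah; apply: a0; apply/lfunP => h'; rewrite zero_lfunE.
  by apply: contrapT => ah'; apply: ah; exists h'.
exact: (form_eigen ah' (cartanC h' h) (ya h')).
Qed.

Lemma loop_linearl (f : series K) : linear (@loop K g ^~ f).
Proof.
move=> a x y; congr pair; last by rewrite /= scaler0 addr0.
by apply/laurentP => k; rewrite laurentD laurentZ /= scalerDr !scalerA mulrC.
Qed.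

Lemma loop_linearr x : linear (loop x).
Proof.
move=> a f h; congr pair; last by rewrite /= scaler0 addr0.
by apply/laurentP => k; rewrite laurentD laurentZ /= scalerDl scalerA.
Qed.

HB.instance Definition _ x := GRing.isLinear.Build K (series K) (affine g) *:%R
  (loop x) (loop_linearr x).

Lemma loop0l f : loop (0 : g) f = 0.
Proof. by have := loop_linearl f (-1) 0 0; rewrite scaler0 addr0 scaleN1r addNr. Qed.

Lemma loopZl c x f : loop (c *: x) f = loop x (c *: f).
Proof. by have := loop_linearl f c x 0; rewrite loop0l !addr0 linearZ. Qed.

(* On a nu-eigenvector the single shift is given by one formula, whether or not
   the vector lies in t. *)
Lemma shift_eigen nu (sigma : {linear affine g -> affine g}) (k : int) y f :
  is_coweight nu -> is_shift nu sigma -> lie (vsval nu) y = k%:~R *: y ->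
  sigma (loop y f) =
    loop y (xi K k * f) + (form (vsval nu) y * res (xi K (- 1) * f)) *: cen.
Proof.
move=> nuC [_ sigma_t sigma_root] yk.
pose good (k : int) (z : g) := lie (vsval nu) z = k%:~R *: z /\ forall f, sigma (loop z f) =
    loop z (xi K k * f) + (form (vsval nu) z * res (xi K (- 1) * f)) *: cen.
have good_sub j : is_subspace (good j).
  split=> [|c u v [uj us] [vj vs]]; split=> [|h].
  - by rewrite linear0 scaler0.
  - by rewrite !loop0l !linear0 mul0r scale0r addr0.
  - by rewrite [LHS]linearP /= uj vj !scalerDr !scalerA mulrC.
  - rewrite !loop_linearl [sigma _]linearP us vs /=.
    have -> : form (vsval nu) (c *: u + v) = c * form (vsval nu) u + form (vsval nu) v.
      exact: linearP.
    by rewrite scalerDr scalerA mulrDl scalerDl mulrA addrACA.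
(* Every vector is a sum of good ones by the root decomposition, but their integers k may differ
   from that of y. *)
pose S x := exists s : seq (int * g), x = \sum_(p <- s) p.2 /\
  forall p, p \in s -> good p.1 p.2.
have [] : S y; last first.
  move=> s [ys sP].
  have sE : eigen_sum (lie (vsval nu)) y (map (fun p => (p.1%:~R : K, p.2)) s).
    split; last by rewrite big_map.
    by move=> p /mapP[q /sP[qn _] ->].
  have kE : eigen_sum (lie (vsval nu)) y [:: (k%:~R : K, y)].
    by split; [move=> p; rewrite inE => /eqP ->|rewrite big_seq1].
  (* The indicator function of the eigenvalue k, evaluated on both decompositions of y, discards the
     summands with other eigenvalues. *)
  have := fcalcE (fun c => (c == k%:~R)%:R) sE.
  rewrite (fcalcE _ kE) big_seq1 big_map /= eqxx scale1r => yE.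
  suff [] : good k y by move=> _; apply.
  rewrite yE; apply: (subspace_sum (good_sub k)) => p /sP pg.
  rewrite eqr_int; case: eqP => [pk|_]; last by rewrite scale0r; exact: (good_sub k).1.
  by rewrite scale1r -pk.
move: {yk} y; apply: root_decomposition.
- split; first by exists [::]; rewrite big_nil.
  move=> c u v [s [us sP]] [t [vt tP]].
  exists (map (fun p => (p.1, c *: p.2)) s ++ t).
  rewrite big_cat big_map /= -scaler_sumr -us -vt; split=> // p.
  rewrite mem_cat => /orP[/mapP[q /sP qg ->]|/tP//].
  exact: (subspaceZ _ (good_sub q.1)).
- move=> h ht; exists [:: (0, h)]; rewrite big_seq1; split=> // p.
  rewrite inE => /eqP -> /=; have hE := vsprojK ht; rewrite -hE.
  by split=> [|f']; [rewrite cartanC scale0r|rewrite sigma_t xi0 mul1r].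
- move=> a z ra az; have [j aj] := nuC _ ra; exists [:: (j, z)]; rewrite big_seq1.
  split=> // p; rewrite inE => /eqP -> /=; split=> [|f']; first by rewrite az aj.
  by rewrite (sigma_root _ _ _ _ ra az aj) (form_root_cartan _ ra az) mul0r scale0r addr0.
Qed.

End SimpleLie.

(** * Highest weight modules *)

Section AffineGenerators.
Variables (K : numFieldType) (g : simpleLie K).

Lemma affine_decomposition (x : affine g) :
  x = \sum_(i < \dim {:g}) loop (vbasis {:g})`_i
        (lmap (coord (vbasis {:g}) i : {linear g -> K^o}) x.1) + x.2 *: cen.
Proof.
case: x => x c; congr pair => /=; last first.
  by rewrite raddf_sum /= big1 ?add0r ?[_ *: _]mulr1// => i _.
rewrite scaler0 addr0 raddf_sum /=; apply/laurentP => k.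
have -> (I : finType) (F : I -> laurent g) : (\sum_i F i) k = \sum_i F i k.
  by apply: (big_morph (fun y : laurent g => y k)).
exact: coord_vbasis (memvf _).
Qed.

Lemma affine_linear_eq (V : lmodType K) (P Q : {linear affine g -> V}) :
  (forall X f, P (loop X f) = Q (loop X f)) -> P cen = Q cen -> P =1 Q.
Proof.
move=> PQ PQc x; rewrite (affine_decomposition x) !linearD !linear_sum !linearZ /= PQc.
by congr (_ + _); apply: eq_bigr.
Qed.

End AffineGenerators.

Section HighestWeightModule.
Local Open Scope classical_set_scope.
Variables (K : numFieldType) (g : simpleLie K) (l : nat) (lam : weight g).
Variable H : hwModule l lam.
Implicit Types (a : weight g) (X Y : g) (f h : series K) (v w : H).

HB.instance Definition _ x := GRing.isLinear.Build K H H *:%R (@act K g l lam H x)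
  (act_linearr (h := H) x).

Definition act_on v : {linear affine g -> H} :=
  HB.pack (fun x => act x v) (GRing.isLinear.Build _ _ _ _ _ (act_linearl (h := H) v)).

Lemma act_sum I (r : seq I) (P : pred I) (F : I -> affine g) v :
  act (\sum_(i <- r | P i) F i) v = \sum_(i <- r | P i) act (F i) v.
Proof. exact: (linear_sum (act_on v)). Qed.

Lemma actDl x y v : act (x + y) v = act x v + act y v.
Proof. exact: (linearD (act_on v)). Qed.

Lemma actZl c x v : act (c *: x) v = c *: act x v.
Proof. exact: (linearZ_LR (act_on v)). Qed.

Lemma act0l v : act 0 v = 0.
Proof. exact: (linear0 (act_on v)). Qed.

Lemma act_loopC X Y f h v :
  act (loop X f) (act (loop Y h) v) = act (loop Y h) (act (loop X f) v) +
    (act (loop (lie X Y) (f * h)) v + (form X Y * res (h * sderiv f) * l%:R) *: v).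
Proof.
have := act_lie (loop X f) (loop Y h) v.
rewrite affine_lieE actDl actZl act_cen scalerA => ->.
by rewrite addrC subrK.
Qed.

(** Stability under loops of root vectors passes to all loops by [simple_generated], so W is a
    submodule. It contains a nonzero highest weight vector, hence everything by irreducibility. *)
Lemma hw_induction (W : set H) : is_subspace W ->
  (forall a X f v, is_root a -> in_root_space a X -> W v -> W (act (loop X f) v)) ->
  (forall v, (forall X f, order_ge 1 f -> act (loop X f) v = 0) ->
     (forall h : cartan_elt g, act (loop (vsval h) 1) v = (lam h : K) *: v) -> W v) ->
  forall v, W v.
Proof.
move=> Wsub Wroot Wtop.
have Wloop X f v : W v -> W (act (loop X f) v).
  move: X f v; apply: simple_generated => [|X Y XW YW f v vW|a X ra aX f v]; last first.
  - exact: Wroot ra aX.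
  (* Bracketing with Y (x) 1 gives [X, Y] (x) f with no central term, the residue of the exact
     differential df being 0. *)
  - have := act_loopC X Y f 1 v; rewrite mulr1 mul1r res_sderiv mulr0 mul0r scale0r addr0.
    rewrite addrC => /(canLR (addrK _)) <-.
    by apply: subspaceB => //; do ?[apply: XW|apply: YW].
  - split=> [f v vW|c X Y XW YW f v vW].
      by rewrite loop0l act0l; exact: Wsub.1.
    rewrite loop_linearl actDl actZl; apply: Wsub.2; [exact: XW|exact: YW].
have Wact x v : W v -> W (act x v).
  move=> vW; rewrite (affine_decomposition x) actDl act_sum actZl act_cen.
  apply: subspaceD => //; last by do 2![apply: subspaceZ => //].
  by apply: subspace_sum => // i _; exact: Wloop.
have [W0|WT] := act_irreducible Wsub Wact; last by move=> v; rewrite WT.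
have [v v0 [v1 _ vh]] := act_highest H.
by have := Wtop v v1 vh; rewrite W0.
Qed.

Lemma act_smooth v : exists N, forall X f, order_ge N f -> act (loop X f) v = 0.
Proof.
move: v; apply: hw_induction.
- split; first by exists 0 => X f _; rewrite linear0.
  move=> c u v [N uN] [M vM]; exists (Order.max N M) => X f fNM.
  rewrite linearP /= uN ?vM ?scaler0 ?addr0//; apply: order_geW fNM; lia.
- move=> a Y h v _ _ [N vN]; have [M hM] := order_ge_exists h.
  (* Large enough for three things at once: f kills v, the product f h kills v, and h df has no
     residue. *)
  exists ((absz N)%:Z + (absz M)%:Z + 1) => X f fN.
  rewrite act_loopC [act (loop X f) v]vN; last by apply: order_geW fN; lia.
  rewrite linear0 add0r vN; last by apply: order_geW (order_geM fN hM); lia.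
  rewrite /res (order_geM hM (order_ge_deriv fN)) ?mulr0 ?mul0r ?scale0r ?addr0//.
  lia.
- by move=> v v1 _; exists 1.
Qed.

End HighestWeightModule.

(** A substitute for c |-> a^c on all of K: choose a representative in each coset of the integers
    and raise a to the integer distance from it. This supplies the torus elements that absorb the
    constants c_j. *)
Lemma quasi_character (K : numFieldType) (a : K) : a != 0 ->
  exists chi : K -> K, (forall c, chi c != 0) /\
    forall c (k : int), chi (c + k%:~R) = a ^ k * chi c.
Proof.
move=> a0; pose rep (c : K) := xget 0 [set r : K | exists k : int, c = r + k%:~R]%classic.
pose ex c := xget 0 [set k : int | c = rep c + k%:~R]%classic.
have exP c : c = rep c + (ex c)%:~R.
  suff /xgetPex : exists k : int, c = rep c + k%:~R by apply.
  have /xgetPex : exists r : K, exists k : int, c = r + k%:~R by exists c, 0; rewrite addr0.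
  by apply.
exists (fun c => a ^ ex c); split=> [c|c k]; first exact: expfz_neq0.
rewrite -expfzDr//; congr (_ ^ _); apply: (@intr_inj K); apply: (@addrI _ (rep (c + k%:~R))).
rewrite -exP; suff -> : rep (c + k%:~R) = rep c by rewrite intrD addrCA -exP addrC.
(* c and c + k have the same candidates for a representative, so the choice returns the same one. *)
congr (xget _ _); apply/seteqP; split=> r [j cE] /=.
  by exists (j - k); rewrite intrB addrA -cE addrK.
by exists (j + k); rewrite intrD addrA -cE.
Qed.

(** The reindexing behind a Cauchy product of two finite sums; the induction peels off the row j =
    0. *)
Lemma triangle_sum (V : nmodType) (G : nat -> nat -> V) (J M : nat) :
  (forall j i, (J <= j)%N -> G j i = 0) -> (forall j i, (M <= i)%N -> G j i = 0) ->
  \sum_(m < J + M) \sum_(j < m.+1) G j (m - j)%N = \sum_(j < J) \sum_(i < M) G j i.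
Proof.
elim: J G => [|J IHJ] G GJ GM.
  by rewrite big_ord0 big1// => m _; rewrite big1// => j _; exact: GJ.
transitivity (\sum_(i < M) G 0%N i + \sum_(m < J + M) \sum_(j < m.+1) G j.+1 (m - j)%N).
2: { rewrite [RHS]big_ord_recl (IHJ (fun j => G j.+1))// => *; by [exact: GJ|exact: GM]. }
under eq_bigr do rewrite big_ord_recl subn0.
rewrite big_split; congr (_ + _) => /=.
  rewrite -!(big_mkord xpredT (G 0%N)) (@big_cat_nat _ _ _ M)//=; last by rewrite leq_addl.
  rewrite [X in _ + X]big1_seq ?addr0// => i; rewrite mem_index_iota => /andP[_ /andP[Mi _]].
  exact: GM.
rewrite big_ord_recl big_ord0 add0r; apply: eq_bigr => m _; apply: eq_bigr => j _.
by rewrite /bump /= add1n subSS.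
Qed.

(** * Exponentials acting on highest weight modules *)

Section ModuleExponential.
Variables (K : numFieldType) (g : simpleLie K) (l : nat) (lam : weight g).
Variable H : hwModule l lam.
Implicit Types (a : weight g) (X Y : g) (f h q : series K) (v w : H) (A : affine g).

Lemma act_cartan_root a X (nu : cartan_elt g) p f v : is_root a -> in_root_space a X ->
  act (loop (vsval nu) p) (act (loop X f) v) =
  act (loop X f) (act (loop (vsval nu) p) v) + act (loop X (((a nu : K) *: p) * f)) v.
Proof.
move=> ra aX; rewrite act_loopC (form_root_cartan _ ra aX) mul0r mul0r scale0r addr0.
by rewrite (aX nu) loopZl scalerAl.
Qed.

Section Nilpotent.
Variables (A : affine g) (X : g) (q : series K).
Hypothesis q1 : order_ge 1 q.
Hypothesis AX : forall f v, act A (act (loop X f) v) =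
  act (loop X f) (act A v) + act (loop X (q * f)) v.

Let T f v j i := act (loop X (q ^+ j * f)) (iter i (act A) v).

(** The Leibniz rule for powers: the commutator with A acts on X (x) f as multiplication of f by
    q. *)
Let iter_loop f v m : iter m (act A) (act (loop X f) v) =
  \sum_(j < m.+1) T f v j (m - j) *+ 'C(m, j).
Proof.
elim: m => [|m IHm]; first by rewrite big_ord1 /T expr0 mul1r.
have AT j i : act A (T f v j i) = T f v j i.+1 + T f v j.+1 i.
  by rewrite /T AX mulrA -exprS.
rewrite iterS IHm linear_sum.
under eq_bigr => j _ do rewrite linearMn /= AT mulrnDl -subSn -1?ltnS//.
rewrite big_split /= [RHS]big_ord_recl /=.
under [X in _ = _ + X]eq_bigr => j _ do rewrite /bump leq0n add1n subSS binS mulrnDr.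
rewrite [X in _ = _ + X]big_split /= addrA; congr (_ + _).
rewrite big_ord_recl /= !bin0 subn0; congr (_ + _).
rewrite [RHS]big_ord_recr /= bin_small// mulr0n addr0.
by apply: eq_bigr => j _; rewrite /bump leq0n add1n subSS.
Qed.

(** Only finitely many of the vectors A^i v are nonzero, so one order N kills them all by
    smoothness. As q has positive order, q^j f reaches that order for large j. *)
Let iter_bound v f : (exists m, iter m (act A) v = 0) -> exists J M : nat,
  [/\ iter M (act A) v = 0, forall j i, (J <= j)%N -> T f v j i = 0 &
  forall s, order_ge J s -> forall i, act (loop X (s * f)) (iter i (act A) v) = 0].
Proof.
move=> [M vM]; have [F fF] := order_ge_exists f.
have [N vN] : exists N : int, forall i Y h, (i < M)%N -> order_ge N h ->
    act (loop Y h) (iter i (act A) v) = 0.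
  elim: M {vM} => [|M [N IHM]]; first by exists 0.
  have [N' vN'] := act_smooth (iter M (act A) v).
  exists (Order.max N N') => i Y h; rewrite ltnS leq_eqVlt => /predU1P[->|iM] hN.
    by apply: vN'; apply: order_geW hN; lia.
  by apply: IHM => //; apply: order_geW hN; lia.
have sN s i : order_ge (`|N - F|%N) s -> act (loop X (s * f)) (iter i (act A) v) = 0.
  move=> sJ; have [iM|Mi] := ltnP i M; last by rewrite (iter_vanish vM Mi) linear0.
  by apply: vN => //; apply: order_geW (order_geM sJ fF); lia.
exists `|N - F|%N, M; split=> // [j i Jj|s sJ i]; last exact: sN.
by apply: sN; apply: order_geW (order_geX (n := j) q1); lia.
Qed.

Lemma act_nilpotent f v : (exists m, iter m (act A) v = 0) ->
  exists m, iter m (act A) (act (loop X f) v) = 0.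
Proof.
move=> /(iter_bound f)[J [M [vM TJ _]]]; exists (J + M)%N; rewrite iter_loop big1// => j _.
have [Jj|jJ] := leqP J j; first by rewrite TJ ?mul0rn.
by rewrite /T (iter_vanish vM) ?linear0 ?mul0rn//; lia.
Qed.

(** Conjugation of X (x) f by exp(A) multiplies f by exp(q). After the Leibniz rule the binomial
    coefficients turn 1/m! into 1/(j! i!), and the double sum becomes a product of two exponential
    series. *)
Lemma expop_loop f v : locally_nilpotent (act (h := H) A) ->
  expop (act A) (act (loop X f) v) = act (loop X (sexp q * f)) (expop (act A) v).
Proof.
move=> An; have [J [M [vM TJ sJ]]] := iter_bound f (An v).
have TM j i : (M <= i)%N -> T f v j i = 0.
  by move=> Mi; rewrite /T (iter_vanish vM) ?linear0.
rewrite (@expopE _ _ _ _ (J + M)); last first.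
  rewrite iter_loop big1// => j _.
  have [Jj|jJ] := leqP J j; first by rewrite TJ ?mul0rn.
  by rewrite TM ?mul0rn//; lia.
pose G j i := (j`!%:R^-1 * i`!%:R^-1) *: T f v j i.
transitivity (\sum_(m < J + M) \sum_(j < m.+1) G j (m - j)%N).
  apply: eq_bigr => m _; rewrite iter_loop scaler_sumr; apply: eq_bigr => j _.
  rewrite -scaler_nat scalerA /G; congr (_ *: _).
  have jm : (j <= m)%N by rewrite -ltnS.
  rewrite -(bin_fact jm) !natrM !invfM mulrAC mulVf ?mul1r//.
  by rewrite pnatr_eq0 -lt0n bin_gt0.
rewrite (@triangle_sum _ G J M) => [|j i Jj|j i Mi]; rewrite /G;
  [|by rewrite TJ// scaler0|by rewrite TM// scaler0].
rewrite (expopE vM) linear_sum exchange_big; apply: eq_bigr => i _ /=.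
rewrite linearZ /=; under eq_bigr => j _ do rewrite mulrC -scalerA.
rewrite -scaler_sumr; congr (_ *: _).
(* The tail of the exponential series has order at least J, so it acts by 0 on every A^i v. *)
have -> : sexp q = (sexp q - \sum_(j < J) j`!%:R^-1 *: q ^+ j) +
    \sum_(j < J) j`!%:R^-1 *: q ^+ j by rewrite subrK.
rewrite mulrDl linearD actDl sJ ?add0r; last exact: powser_trunc.
rewrite mulr_suml linear_sum act_sum; apply: eq_bigr => j _.
by rewrite -scalerAl linearZ actZl.
Qed.

End Nilpotent.
End ModuleExponential.

(** * Twisting isomorphisms between highest weight modules *)

Section Twists.
Local Open Scope classical_set_scope.
Variables (K : numFieldType) (g : simpleLie K) (l n : nat).
Variable nus : 'I_n -> cartan_elt g.
Implicit Types (a lam : weight g) (k : 'I_n -> int).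

(* T intertwines X (x) f with X (x) m_a f for every root vector X of root a,
   where m_a depends on a only through its values k_j on the nu_j. *)
Definition is_twist lam lam' (H : hwModule l lam) (H' : hwModule l lam')
    (m : ('I_n -> int) -> series K) (T : H -> H') : Prop :=
  [/\ linear T, bijective T & forall a X k,
      is_root a -> in_root_space a X -> \sum_j k j = 0 ->
      (forall j, a (nus j) = (k j)%:~R :> K) ->
      forall f v, T (act (loop X f) v) = act (loop X (m k * f)) (T v)].

Lemma twist_comp lam lam' lam'' (H : hwModule l lam) (H' : hwModule l lam')
    (H'' : hwModule l lam'') m m' (T : H -> H') (T' : H' -> H'') :
  is_twist m T -> is_twist m' T' -> is_twist (fun k => m' k * m k) (T' \o T).
Proof.
move=> [TL Tb Tm] [TL' Tb' Tm']; split; first by move=> c u v; rewrite /= TL TL'.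
  exact: bij_comp.
by move=> a X k ra aX k0 ak f v; rewrite /= (Tm _ _ _ ra aX k0 ak) (Tm' _ _ _ ra aX k0 ak) mulrA.
Qed.

Lemma twist_ext lam lam' (H : hwModule l lam) (H' : hwModule l lam') m m' (T : H -> H') :
  (forall k, \sum_j k j = 0 -> m k = m' k) -> is_twist m T -> is_twist m' T.
Proof.
move=> mm' [TL Tb Tm]; split=> // a X k ra aX k0 ak f v.
by rewrite -mm'// (Tm _ _ _ ra aX k0 ak).
Qed.

Lemma twist_scale lam (H : hwModule l lam) (c : K) : c != 0 ->
  is_twist (fun=> 1) ( *:%R c : H -> H).
Proof.
move=> c0; split.
- by move=> b u v; rewrite scalerDr !scalerA mulrC.
- by exists ( *:%R c^-1) => v; rewrite scalerA ?mulVf ?divff// scale1r.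
by move=> a X k _ _ _ _ f v; rewrite mul1r linearZ.
Qed.

Lemma twist_shift (i : 'I_n) lam lam' (H : hwModule l lam) (H' : hwModule l lam')
    (sigma : {linear affine g -> affine g}) (Theta : {linear H -> H'}) :
  is_shift (nus i) sigma -> bijective Theta ->
  (forall x v, Theta (act x v) = act (sigma x) (Theta v)) ->
  is_twist (fun k => xi K (k i)) Theta.
Proof.
move=> [_ _ sigma_root] Tb Tsigma; split=> // [|a X k ra aX k0 ak f v].
  exact: linearP.
by rewrite Tsigma (sigma_root _ _ _ _ ra aX (ak i)).
Qed.

Variables (lam : weight g) (H : hwModule l lam).

(** The highest weight vector is an eigenvector, and a loop of a root vector of root a shifts
    eigenvalues by a(nu). *)
Lemma act_cartan_diagonalizable (nu : cartan_elt g) :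
  diagonalizable_op (act (h := H) (loop (vsval nu) 1)).
Proof.
have Wsub := diagonalizable_subspace (act (h := H) (loop (vsval nu) 1)).
apply: hw_induction => // [a X f v ra aX [s [sN ->]]|v _ vh]; last first.
  exists [:: (lam nu : K, v)]; split; last by rewrite big_seq1.
  by move=> p; rewrite inE => /eqP ->; exact: vh.
exists (map (fun p => (p.1 + a nu, act (loop X f) p.2)) s); split.
  apply: eigen_seq_map sN => p pN /=.
  by rewrite (act_cartan_root _ _ _ _ ra aX) -scalerAl mul1r linearZ actZl pN linearZ scalerDl.
by rewrite big_map linear_sum.
Qed.

(** [chi] of the Cartan operator plays the torus element c^(nu_j): a root vector shifts the
    eigenvalue by k_j, and [chi] turns this into the factor c^(k_j). *)
Lemma twist_torus (chi : K -> K) (c : K) (j : 'I_n) :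
  (forall x, chi x != 0) -> (forall x (k : int), chi (x + k%:~R) = c ^ k * chi x) ->
  is_twist (fun k => (c ^ k j)%:A) (fcalc (act (h := H) (loop (vsval (nus j)) 1)) chi).
Proof.
move=> chi0 chiE; have Nd := act_cartan_diagonalizable (nus j).
have inv (x1 x2 : K -> K) (v : H) : (forall x, x1 x * x2 x = 1) ->
    fcalc (act (loop (vsval (nus j)) 1)) x1 (fcalc (act (loop (vsval (nus j)) 1)) x2 v) = v.
  by move=> x12; rewrite fcalcM// -[RHS](fcalc1 v Nd); congr (fcalc _ _ _); apply/funext.
split.
- exact: fcalc_linear.
- by exists (fcalc (act (loop (vsval (nus j)) 1)) (fun x => (chi x)^-1)) => v;
    apply: inv => x; rewrite ?mulVf ?divff.
move=> a X k ra aX k0 ak f v.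
rewrite (fcalc_shift (P := act (loop X f)) (k := (k j)%:~R) _ _ Nd) => [|u].
  have -> : (fun x => chi (x + (k j)%:~R)) = fun x => c ^ k j * chi x by apply/funext => x.
  by rewrite fcalcZ// linearZ mulr_algl linearZ actZl.
by rewrite /= (act_cartan_root _ _ _ _ ra aX) -scalerAl mul1r linearZ actZl ak.
Qed.

Variable p : 'I_n -> series K.
Hypothesis p1 : forall j, order_ge 1 (p j).

Definition heis_elt : affine g := \sum_j loop (vsval (nus j)) (p j).

Let heisC a X f v : is_root a -> in_root_space a X ->
  act heis_elt (act (loop X f) v) = act (loop X f) (act heis_elt v) +
    act (loop X ((\sum_j (a (nus j) : K) *: p j) * f)) (v : H).
Proof.
move=> ra aX; rewrite /heis_elt !act_sum linear_sum mulr_suml linear_sum act_sum -big_split.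
by apply: eq_bigr => j _; rewrite (act_cartan_root _ _ _ _ ra aX).
Qed.

(** The p_j have positive order, so the element kills the highest weight vector; [act_nilpotent]
    carries nilpotency through loops of root vectors. *)
Lemma heis_nilpotent : locally_nilpotent (act (h := H) heis_elt).
Proof.
move=> v; have q1 a : order_ge 1 (\sum_j (a (nus j) : K) *: p j).
  by apply: order_ge_sum => j _; exact: order_geZ.
move: v; apply: hw_induction => [|a X f v ra aX vm|v v1 _].
- split=> [|c u v [i ui] [j vj]]; first by exists 0%N.
  exists (maxn i j); rewrite iter_lin (iter_vanish ui) ?(iter_vanish vj) ?leq_maxl ?leq_maxr//.
  by rewrite scaler0 addr0.
- exact: (act_nilpotent (q1 a) (fun h w => heisC h w ra aX) f vm).
- exists 1%N; rewrite /= /heis_elt act_sum big1// => j _; exact: v1.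
Qed.

Lemma twist_exp : is_twist (fun k => sexp (\sum_j p j *~ k j)) (expop (act (h := H) heis_elt)).
Proof.
have An := heis_nilpotent; split; [exact: expop_linear|exact: expop_bij|].
move=> a X k ra aX k0 ak f v.
have q1 : order_ge 1 (\sum_j (a (nus j) : K) *: p j).
  by apply: order_ge_sum => j _; exact: order_geZ.
have <- : \sum_j (a (nus j) : K) *: p j = \sum_j p j *~ k j.
  by apply: eq_bigr => j _; rewrite ak scaler_int.
exact: (expop_loop q1 (fun h w => heisC h w ra aX) f v An).
Qed.

End Twists.

(** * Branching *)

Lemma linear_packed (K : fieldType) (U V : lmodType K) (f : U -> V) : linear f ->
  exists F : {linear U -> V}, F =1 f.
Proof.
move=> fL; pose F : {linear U -> V} := HB.pack f (GRing.isLinear.Build _ _ _ _ _ fL).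
by exists F.
Qed.

Section Branching.
Local Open Scope classical_set_scope.
Variables (K : numFieldType) (g1 g2 g : simpleLie K).
Variable phi : {linear (g1 * g2)%type -> g}.
Variables l1 l2 : nat.
Hypotheses (phi_emb : is_lie_embedding phi) (phi_index : has_dynkin_index phi l1 l2).
Hypothesis phi_cartanP : preserves_cartan phi.
Implicit Types (X : g1) (Y : g2) (mu : cartan_elt g2) (f : series K).

Lemma hat_phi1_loop X f : hat_phi1 phi l1 (loop X f) = loop (phi1 phi X) f.
Proof.
congr pair; last by rewrite /= mulr0.
by apply/laurentP => k /=; rewrite linearZ.
Qed.

Lemma hat_phi2_loop Y f : hat_phi2 phi l2 (loop Y f) = loop (phi2 phi Y) f.
Proof.
congr pair; last by rewrite /= mulr0.
by apply/laurentP => k /=; rewrite linearZ.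
Qed.

Lemma hat_phi1_linear : linear (hat_phi1 phi l1).
Proof.
move=> a [x c] [y d]; congr pair; last by rewrite /= mulrDr mulrCA.
by apply/laurentP => k /=; rewrite [LHS]linearP.
Qed.

Lemma hat_phi2_linear : linear (hat_phi2 phi l2).
Proof.
move=> a [x c] [y d]; congr pair; last by rewrite /= mulrDr mulrCA.
by apply/laurentP => k /=; rewrite [LHS]linearP.
Qed.

HB.instance Definition _ := GRing.isLinear.Build K (affine g1) (affine g) *:%R
  (hat_phi1 phi l1) hat_phi1_linear.
HB.instance Definition _ := GRing.isLinear.Build K (affine g2) (affine g) *:%R
  (hat_phi2 phi l2) hat_phi2_linear.

Lemma hat_phi1_cen : hat_phi1 phi l1 cen = l1%:R *: cen.
Proof. by congr pair; rewrite ?scaler0 ?mulr1//; apply/laurentP => k /=; rewrite linear0. Qed.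

Lemma hat_phi2_cen : hat_phi2 phi l2 cen = l2%:R *: cen.
Proof. by congr pair; rewrite ?scaler0 ?mulr1//; apply/laurentP => k /=; rewrite linear0. Qed.

Lemma phi1_lie X X' : phi1 phi (lie X X') = lie (phi1 phi X) (phi1 phi X').
Proof. by rewrite /phi1 -phi_emb.2 /= lie0l. Qed.

Lemma phi2_lie Y Y' : phi2 phi (lie Y Y') = lie (phi2 phi Y) (phi2 phi Y').
Proof. by rewrite /phi2 -phi_emb.2 /= lie0l. Qed.

Lemma phi12_lie Y X : lie (phi2 phi Y) (phi1 phi X) = 0.
Proof. by rewrite /phi2 /phi1 -phi_emb.2 /= lie0l lie0r linear0. Qed.

Lemma phi_cartanE mu : vsval (phi_cartan phi mu) = phi2 phi (vsval mu).
Proof. by rewrite vsprojK// phi_cartanP ?mem0v ?subvsP. Qed.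

(** Against a bracket [X1, X2] the form vanishes by invariance, because the two images commute. A
    root vector is itself a multiple of a bracket [h, X]. *)
Lemma phi12_form Y X : form (phi2 phi Y) (phi1 phi X) = 0.
Proof.
have brac X1 X2 : form (phi2 phi Y) (phi1 phi (lie X1 X2)) = 0.
  by rewrite phi1_lie -form_inv phi12_lie form_sym linear0.
move: X; apply: simple_generated => [|X1 X2 _ _|a X ra aX].
- split=> [|c X1 X2 e1 e2]; first by rewrite !linear0.
  by rewrite !linearP /= e1 e2 scaler0 addr0.
- exact: brac.
have [h /eqP ah] : exists h, (a h : K) <> 0.
  have [a0 _] := ra; apply: contrapT => ah; apply: a0; apply/lfunP => h; rewrite zero_lfunE.
  by apply: contrapT => ah'; apply: ah; exists h.
have := brac (vsval h) X; rewrite aX !linearZ => /eqP.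
by rewrite mulf_eq0 (negPf ah) => /eqP.
Qed.

Section Shift.
Variables (mu : cartan_elt g2) (sigma : {linear affine g2 -> affine g2}).
Variable sigma' : {linear affine g -> affine g}.
Hypotheses (muC : is_coweight mu) (muC' : is_coweight (phi_cartan phi mu)).
Hypotheses (sigmaP : is_shift mu sigma) (sigmaP' : is_shift (phi_cartan phi mu) sigma').

(** The image of g_1 commutes with phi(mu) and is orthogonal to it, so neither the power of [xi] nor
    the central term changes. *)
Lemma shift_hat_phi1 x : sigma' (hat_phi1 phi l1 x) = hat_phi1 phi l1 x.
Proof.
move: x; apply: (affine_linear_eq (P := sigma' \o hat_phi1 phi l1)) => [X f|] /=.
  rewrite hat_phi1_loop (shift_eigen (k := 0) _ muC' sigmaP'); last first.
    by rewrite scale0r phi_cartanE phi12_lie.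
  by rewrite phi_cartanE phi12_form mul0r scale0r addr0 xi0 mul1r.
by rewrite hat_phi1_cen linearZ /=; have [-> _ _] := sigmaP'.
Qed.

(** A root vector of g_2 need not map to a root vector of g, but it maps to an eigenvector of
    phi(mu) with the same eigenvalue, so [shift_eigen] applies on both sides. The Dynkin index
    matches the central terms. *)
Lemma shift_hat_phi2 x : sigma' (hat_phi2 phi l2 x) = hat_phi2 phi l2 (sigma x).
Proof.
have [sc st sr] := sigmaP.
move: x; apply: (affine_linear_eq (P := sigma' \o hat_phi2 phi l2)
    (Q := hat_phi2 phi l2 \o sigma)) => [Y f|] /=; last first.
  by rewrite sc hat_phi2_cen linearZ /=; have [-> _ _] := sigmaP'.
have eigen (k : int) y : lie (vsval mu) y = k%:~R *: y ->
    sigma' (hat_phi2 phi l2 (loop y f)) = hat_phi2 phi l2 (sigma (loop y f)).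
  move=> yk; rewrite (shift_eigen _ muC sigmaP yk) linearD linearZ /= hat_phi2_cen.
  rewrite !hat_phi2_loop (shift_eigen (k := k) _ muC' sigmaP'); last first.
    by rewrite phi_cartanE -phi2_lie yk linearZ.
  by rewrite phi_cartanE phi_index.2 scalerA; congr (_ + _ *: _); rewrite -mulrA mulrC.
move: Y; apply: root_decomposition => [|h ht|a y ra ay].
- split=> [|c u v eu ev]; first by rewrite loop0l !linear0.
  by rewrite loop_linearl !linearP /= eu ev.
- by apply: (eigen 0); have [tt _ _] := cartanP g2; rewrite tt ?subvsP// scale0r.
- by have [k ak] := muC ra; apply: (eigen k); rewrite ay ak.
Qed.


Lemma branching_transfer (lam : weight g1) (gam ogam : weight g2) (Lam OLam : weight g)
    (H1 : hwModule l1 lam) (H2 : hwModule l2 gam) (H2' : hwModule l2 ogam)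
    (H : hwModule 1%N Lam) (H' : hwModule 1%N OLam) (psi : H1 -> H2 -> H)
    (psi' : H1 -> H2' -> H') (Theta2 : {linear H2 -> H2'}) (Theta : {linear H -> H'}) :
  bijective Theta2 -> bijective Theta ->
  (forall x v, Theta2 (act x v) = act (sigma x) (Theta2 v)) ->
  (forall x v, Theta (act x v) = act (sigma' x) (Theta v)) ->
  multiplicity_one phi H1 H2 H ->
  is_branching phi psi -> is_nonzero psi -> is_branching phi psi' -> is_nonzero psi' ->
  exists2 c : K, c != 0 & forall v w, psi' v (Theta2 w) = c *: Theta (psi v w).
Proof.
move=> [T2 T2K KT2] [T TK KT] Theta2E ThetaE [psi0 [_ _ psi0P]] psiB psiN [[pl pr] p1 p2] pN.
(* Pulling [psi'] back along the two isomorphisms gives an intertwiner for the original modules, to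
   be compared with [psi] by multiplicity one. *)
pose chi v w := T (psi' v (Theta2 w)).
have TL : linear T by move=> a u v; apply: (can_inj TK); rewrite linearP !KT.
have Tact x u : T (act (sigma' x) u) = act x (T u).
  by apply: (can_inj TK); rewrite ThetaE !KT.
have chiB : is_branching phi chi.
  split.
  - split=> [w a u v|v a u w]; first by rewrite /chi pl TL.
    by rewrite /chi linearP pr TL.
  - by move=> x v w; rewrite /chi p1 -Tact shift_hat_phi1.
  - by move=> y v w; rewrite /chi Theta2E p2 -Tact shift_hat_phi2.
have [d dE] := psi0P _ psiB; have [c cE] := psi0P _ chiB.
have d0 : d != 0.
  apply/eqP => d0; have [u [v]] := psiN; apply.
  by rewrite dE d0 scale0r.
have psiE v w : psi' v (Theta2 w) = (c / d) *: Theta (psi v w).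
  by apply: (can_inj KT); rewrite -linearZ TK dE scalerA divfK//; exact: cE.
exists (c / d) => //; apply/eqP => cd0.
have [u [v]] := pN; apply.
by rewrite -[v]KT2 psiE cd0 scale0r.
Qed.

End Shift.

Section Pair.
Variables (n : nat) (mus : 'I_n -> cartan_elt g2).
Variables (lam : weight g1) (gam : weight g2) (Lam : weight g).
Variables (H1 : hwModule l1 lam) (H2 : hwModule l2 gam) (H : hwModule 1%N Lam).
Variables (psi : H1 -> H2 -> H) (c : 'I_n -> K) (p : 'I_n -> series K).
Hypotheses (psiB : is_branching phi psi) (c0 : forall j, c j != 0).
Hypothesis p1 : forall j, order_ge 1 (p j).
Local Notation nus := (fun j => phi_cartan phi (mus j)).

Let psi_loop v w Y f : psi v (act (loop Y f) w) = act (loop (phi2 phi Y) f) (psi v w).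
Proof. by have [_ _ ->] := psiB; rewrite hat_phi2_loop. Qed.

Let psi_linear v : exists P : {linear H2 -> H}, P =1 psi v.
Proof. by have [[_ pr] _ _] := psiB; exact: linear_packed. Qed.

(** The same [chi] is used on both modules: psi v intertwines the operator of mu_j with that of
    phi(mu_j), hence also their functional calculi. *)
Let torus_pair (s : seq 'I_n) : exists (R2 : H2 -> H2) (R : H -> H),
  [/\ is_twist mus (fun k => (\prod_(j <- s) c j ^ k j)%:A) R2,
      is_twist nus (fun k => (\prod_(j <- s) c j ^ k j)%:A) R &
      forall v w, psi v (R2 w) = R (psi v w)].
Proof.
elim: s => [|j s [R2 [R [R2t Rt RE]]]].
  exists ( *:%R 1), ( *:%R 1); split=> [||v w]; last by rewrite !scale1r.
    by apply: twist_ext (twist_scale _ _ (oner_neq0 K)) => k _; rewrite big_nil scale1r.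
  by apply: twist_ext (twist_scale _ _ (oner_neq0 K)) => k _; rewrite big_nil scale1r.
have [chi [chi0 chiE]] := quasi_character (c0 j).
have t2 := twist_torus mus H2 j chi0 chiE.
have t := twist_torus nus H j chi0 chiE.
exists (fcalc (act (loop (vsval (mus j)) 1)) chi \o R2).
exists (fcalc (act (loop (vsval (nus j)) 1)) chi \o R).
split=> [||v w].
- by apply: twist_ext (twist_comp R2t t2) => k _; rewrite big_cons mulr_algl scalerA.
- by apply: twist_ext (twist_comp Rt t) => k _; rewrite big_cons mulr_algl scalerA.
have [P PE] := psi_linear v; rewrite /= -RE -!PE; apply/esym.
apply: fcalc_comm => [|u]; first exact: act_cartan_diagonalizable.
by rewrite /= !PE phi_cartanE psi_loop.
Qed.

Lemma twist_pair : exists (R2 : H2 -> H2) (R : H -> H),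
  [/\ is_twist mus (fun k => (\prod_j c j ^ k j) *: sexp (\sum_j p j *~ k j)) R2,
      is_twist nus (fun k => (\prod_j c j ^ k j) *: sexp (\sum_j p j *~ k j)) R &
      forall v w, psi v (R2 w) = R (psi v w)].
Proof.
have [R2 [R [R2t Rt RE]]] := torus_pair (index_enum _).
exists (R2 \o expop (act (heis_elt mus p))), (R \o expop (act (heis_elt nus p))).
split=> [||v w].
- by apply: twist_ext (twist_comp (twist_exp _ _ p1) R2t) => k _; rewrite mulr_algl.
- by apply: twist_ext (twist_comp (twist_exp _ _ p1) Rt) => k _; rewrite mulr_algl.
have [P PE] := psi_linear v; rewrite /= RE -!PE; congr R; apply/esym.
apply: expop_comm => [|u]; first exact: heis_nilpotent.
rewrite /heis_elt /= !act_sum linear_sum; apply: eq_bigr => j _.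
by rewrite !PE phi_cartanE psi_loop.
Qed.

End Pair.
End Branching.

(** * Coinvariants *)

Section Expansions.
Variables (K : numFieldType) (n : nat) (X : pointedLine K n).
Local Notation "p %:F" := (tofrac p) (at level 1).
Implicit Types (k : 'I_n -> int) (i j : 'I_n).

(* z - p_j, or 1 if the j-th point is at infinity, and its order at the i-th point. *)
Definition point_factor j : {poly K} := if point X j is Some p then 'X - p%:P else 1.

Definition point_order i j : int :=
  if point X i is Some _ then (i == j)%:Z else - (i != j)%:Z.

Definition point_series i j : series K := horner_alg (zexp X i) (point_factor j).

Lemma point_factor_neq0 j : point_factor j != 0.
Proof. by rewrite /point_factor; case: (point X j) => [p|]; rewrite ?polyXsubC_eq0 ?oner_neq0. Qed.

Lemma horner_alg_XsubC (z : series K) (p : K) : horner_alg z ('X - p%:P) = z - p *: 1.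
Proof. by rewrite rmorphB /= horner_algX horner_algC. Qed.

Lemma point_seriesE i j : exists2 c : K, c != 0 & exists2 p, order_ge 1 p &
  point_series i j = c *: (xi K (point_order i j) * sexp p).
Proof.
have one : order_ge 0 (1 : series K) /\ (1 : series K) 0 <> 0.
  by split; [exact: order_ge1|rewrite scoef1; apply/eqP; exact: oner_neq0].
suff [] : order_ge (point_order i j) (point_series i j) /\
    point_series i j (point_order i j) <> 0 by exact: leading_term.
have inj : i != j -> point X i <> point X j.
  by move=> /eqP ij /point_inj.
have := zexpP X i; rewrite /point_order /point_series /point_factor.
case pi: (point X i) => [p|]; case pj: (point X j) => [q|].
- rewrite horner_alg_XsubC; have [ij|ij] := eqVneq i j.
    by move: pj; rewrite -ij pi => -[->] [].
  move=> [_ zp].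
  (* At a finite point p the factor z - q is the local parameter z - p plus the nonzero constant p -
     q. *)
  have zq : zexp X i - q *: 1 = (zexp X i - p *: 1) + (p - q) *: 1.
    by rewrite scalerBl addrA subrK.
  rewrite zq; split.
    apply: order_geD; last by apply: order_geZ; exact: order_ge1.
    by move=> l l0; apply: zp; lia.
  rewrite seriesD zp// add0r seriesZ scoef1 mulr1 => /eqP; rewrite subr_eq0 => /eqP pq.
  by apply: (inj ij); rewrite pi pj pq.
- move=> _; rewrite rmorph1; have [ij|_] := eqVneq i j; last exact: one.
  by move: pj; rewrite -ij pi.
- rewrite horner_alg_XsubC; have [ij|ij] := eqVneq i j.
    by move: pj; rewrite -ij pi.
  move=> [z1 z0]; split.
    apply: order_geB; first exact: z0.
    by apply: order_geZ; apply: (@order_geW _ 0) => //; exact: order_ge1.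
  by rewrite seriesB seriesZ scoef1 mulr0 subr0.
- move=> _; rewrite rmorph1; have [_|ij] := eqVneq i j; first exact: one.
  by have := inj ij; rewrite pi pj.
Qed.

Lemma point_series_unit i j : point_series i j \is a GRing.unit.
Proof. by have [c c0 [p p1 ->]] := point_seriesE i j; exact: leading_unit. Qed.

(** At infinity each other factor has a simple pole, and the total - sum_(j != i) k_j equals k_i
    because the exponents sum to 0. *)
Lemma sum_point_order i k : \sum_j k j = 0 -> \sum_j point_order i j * k j = k i.
Proof.
move=> k0; rewrite /point_order; case: (point X i) => [_|].
  rewrite (bigD1 i)//= eqxx mul1r big1 ?addr0// => j; rewrite eq_sym => /negPf ->.
  by rewrite mul0r.
rewrite (bigD1 i)//= eqxx oppr0 mul0r add0r.
move: k0; rewrite (bigD1 i)//= => /eqP; rewrite addr_eq0 => /eqP ->; rewrite -sumrN.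
by apply: eq_bigr => j; rewrite eq_sym => ->; rewrite mulN1r.
Qed.

(* The expansion at the i-th point of the product of the (z - p_j)^(k_j). *)
Definition twist_series k i : series K := \prod_j point_series i j ^ k j.

Lemma twist_seriesE i : exists (c : 'I_n -> K) (p : 'I_n -> series K),
  [/\ forall j, c j != 0, forall j, order_ge 1 (p j) & forall k, \sum_j k j = 0 ->
    twist_series k i = xi K (k i) * ((\prod_j c j ^ k j) *: sexp (\sum_j p j *~ k j))].
Proof.
have /choice[c cP] : forall j, exists c : K, c != 0 /\ exists2 p, order_ge 1 p &
    point_series i j = c *: (xi K (point_order i j) * sexp p).
  by move=> j; have [c c0 cE] := point_seriesE i j; exists c.
have /choice[p pP] : forall j, exists p, order_ge 1 p /\
    point_series i j = c j *: (xi K (point_order i j) * sexp p).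
  by move=> j; have [_ [p p1 pE]] := cP j; exists p.
exists c, p; split=> [j|j|k k0]; [exact: (cP j).1|exact: (pP j).1|].
rewrite -[in xi K (k i)](sum_point_order i k0) /twist_series.
rewrite -scalerAr; elim: (index_enum _) => [|j r IHr].
  by rewrite !big_nil sexp0 mulr1 scale1r.
have [p1 pE] := pP j; rewrite !big_cons IHr pE leadingX//; last exact: (cP j).1.
rewrite -xiM sexpD; last 2 first.
- exact: order_ge_mulz.
- by apply: order_ge_sum => j' _; apply: order_ge_mulz; exact: (pP j').1.
by rewrite -scalerAl -scalerAr scalerA mulrACA.
Qed.

Lemma twist_seriesV k i : twist_series k i * twist_series (fun j => - k j) i = 1.
Proof.
rewrite -big_split big1//= => j _.
by rewrite -exprzDr ?subrr//; exact: point_series_unit.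
Qed.

(* Multiplication by m is induced by multiplication by a rational function. *)
Definition is_multiplier (m : 'I_n -> series K) : Prop := forall f s,
  regular_away X f -> (forall i, is_expansion X i f (s i)) ->
  exists2 f', regular_away X f' & forall i, is_expansion X i f' (m i * s i).

Definition pos_part (k : int) : nat := if k is Posz m then m else 0%N.
Definition neg_part (k : int) : nat := if k is Negz m then m.+1 else 0%N.

Lemma pos_negE (k : int) : k = (pos_part k)%:Z - (neg_part k)%:Z.
Proof. by case: k => m /=; lia. Qed.

Lemma exprz_pos_neg (x : series K) (k : int) : x \is a GRing.unit ->
  x ^ k * x ^+ neg_part k = x ^+ pos_part k.
Proof.
by move=> xU; rewrite {1}(pos_negE k) exprzDr// -mulrA -exprnN mulVr ?unitrX// mulr1.
Qed.

Lemma twist_series_multiplier k : \sum_j k j = 0 -> is_multiplier (twist_series k).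
Proof.
move=> k0 f s [N [D [D0 fE Droot Dsize]]] sP.
(* A / B is the product of the (z - p_j)^(k_j), split by the sign of the exponent. *)
pose A := \prod_j point_factor j ^+ pos_part (k j).
pose B := \prod_j point_factor j ^+ neg_part (k j).
have B0 : B != 0 by apply/prodf_neq0 => j _; rewrite expf_neq0// point_factor_neq0.
have A0 : A != 0 by apply/prodf_neq0 => j _; rewrite expf_neq0// point_factor_neq0.
have fE' (N' D' : {poly K}) : f = N'%:F / D'%:F ->
    f * (A%:F / B%:F) = (N' * A)%:F / (D' * B)%:F.
  by move=> ->; rewrite mulf_div !tofracM.
exists (f * (A%:F / B%:F)) => [|i].
- exists (N * A), (D * B); split; [by rewrite mulf_neq0|exact: fE'| |].
    move=> p; rewrite rootM => /orP[/Droot//|].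
    rewrite /B /root horner_prod => /prodf_eq0[j _].
    rewrite horner_exp expf_eq0 => /andP[_]; rewrite /point_factor.
    case pj: (point X j) => [q|]; last by rewrite hornerC oner_eq0.
    by rewrite hornerXsubC subr_eq0 => /eqP ->; exists j.
  (* If infinity is not marked, regularity there is the degree bound. Since the k_j sum to 0, A and
     B have equal degree and the bound persists. *)
  have [inf|fin] := pselect (exists i, point X i = None); [by left|right].
  have szp (e : 'I_n -> nat) : size (\prod_j point_factor j ^+ e j) = (\sum_j e j).+1.
    elim: (index_enum _) => [|j r IHr]; first by rewrite !big_nil size_poly1.
    rewrite !big_cons size_mul; last 2 first.
    - by rewrite expf_neq0// point_factor_neq0.
    - by rewrite prodf_seq_neq0; apply/allP => j' _; rewrite expf_neq0// point_factor_neq0.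
    rewrite IHr /point_factor; case pj: (point X j) => [q|].
      by rewrite size_exp_XsubC !addSn !addnS.
    by case: fin; exists j.
  have AB : size A = size B.
    rewrite !szp; congr _.+1; apply/eqP; rewrite -eqz_nat -!natz !natr_sum -subr_eq0 -sumrB.
    by apply/eqP; rewrite -[RHS]k0; apply: eq_bigr => j _; rewrite !natz -pos_negE.
  have [->|N0] := eqVneq N 0; first by rewrite mul0r size_poly0.
  rewrite !size_mul// AB -!subn1 leq_sub2r// leq_add2r.
  by case: Dsize => // inf; case: fin.
have [N' [D' [D'0 fND sDN]]] := sP i; exists (N' * A), (D' * B); split.
- by rewrite mulf_neq0.
- exact: fE'.
suff BA : twist_series k i * horner_alg (zexp X i) B = horner_alg (zexp X i) A.
  have hM p q : horner_alg (zexp X i) (p * q) = horner_alg (zexp X i) p * horner_alg (zexp X i) q.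
    exact: rmorphM.
  by rewrite !hM -sDN -BA; ring.
rewrite !rmorph_prod -big_split; apply: eq_bigr => j _; rewrite !rmorphXn.
exact: exprz_pos_neg (point_series_unit i j).
Qed.

End Expansions.

(** * Maps between spaces of coinvariants *)

Section Coinvariants.
Variables (K : numFieldType) (g : simpleLie K) (l n : nat).
Variables (X : pointedLine K n) (lam : 'I_n -> weight g).
Variable H : forall i, hwModule l (lam i).

Lemma proj0 (V : lmodType K) (S : set V) : proj S 0 = 0 :> quot S.
Proof.
by have := @proj_linear K V S (- 1) 0 0; rewrite scaler0 addr0 scaleN1r addNr.
Qed.

Lemma coinv_class_multilinear : is_multilinear (coinv_class X (H := H)).
Proof.
move=> v i a x y; rewrite /coinv_class -proj_linear; congr proj.
rewrite /ptens -proj_linear; apply/projP; apply/asboolP => W _ SW; apply: SW.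
by exists v, i, a, x, y.
Qed.

Lemma coinv_class_invariant : is_gauge_invariant X (coinv_class X (H := H)).
Proof.
move=> Y f s v fX sf.
rewrite /coinv_class -(big_morph _ (@projD _ _ _) (proj0 _)).
rewrite -[RHS](proj0 (gauge_image X (H := H))); apply/projP; rewrite subr0.
by apply/asboolP => W _ SW; apply: SW; exists Y, f, s, v.
Qed.

(** Composed with the surjection from the free module on tuples, both maps are linear and agree on
    generators. *)
Lemma coinvariants_ext (W : lmodType K) (F G : coinvariants X H -> W) :
  linear F -> linear G -> (forall v, F (coinv_class X v) = G (coinv_class X v)) -> F =1 G.
Proof.
move=> FL GL FG q; pose pr := (proj (gauge_image X (H := H)) \o proj (@multilinear_rel K n H)).
have prL : linear pr by move=> a x y; rewrite /pr /= !proj_linear.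
have [F' FE] : exists F' : {linear {freeg (forall i, H i) / K} -> W}, F' =1 F \o pr.
  by apply: linear_packed => a x y /=; rewrite prL FL.
have [G' GE] : exists G' : {linear {freeg (forall i, H i) / K} -> W}, G' =1 G \o pr.
  by apply: linear_packed => a x y /=; rewrite prL GL.
rewrite -[q]lift_reprK -[lift_repr q]lift_reprK -[LHS]FE -[RHS]GE.
set d := lift_repr _; rewrite -(freeg_sumE d) !linear_sum; apply: eq_bigr => v _.
have -> : << coeff v d *g v >> = coeff v d *: << v >> :> {freeg (forall i, H i) / K}.
  by apply/eqP/freeg_eqP => x; rewrite coeffZ !coeffU mul1r.
by rewrite !linearZ FE GE; congr (_ *: _); exact: FG.
Qed.

End Coinvariants.

Section CoinvariantsMap.
Variables (K : numFieldType) (g : simpleLie K) (l n : nat) (X : pointedLine K n).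
Variables (lam lam' : 'I_n -> weight g).
Variables (H : forall i, hwModule l (lam i)) (H' : forall i, hwModule l (lam' i)).
Variable T : forall i, H i -> H' i.
Hypothesis T_linear : forall i, linear (@T i).
Hypothesis T_root : forall (a : weight g) Y, is_root a -> in_root_space a Y ->
  exists2 m, is_multiplier X m & forall i f v,
    T (act (loop Y f) v) = act (loop Y (m i * f)) (T (v : H i)).

Let F v : coinvariants X H' := coinv_class X (fun i => T (v i)).

Let Tdfwith v i (x : H i) : (fun j => T (dfwith v i x j)) =
  dfwith (T := fun j => H' j) (fun j => T (v j)) i (T x).
Proof.
apply: functional_extensionality_dep => j.
by case: dfwithP => [|k ik]; [rewrite dfwithin|rewrite dfwithout].
Qed.

Let F_multi : is_multilinear F.
Proof. by move=> v i a x y; rewrite /F !Tdfwith T_linear; exact: coinv_class_multilinear. Qed.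

Let F0 v i : F (dfwith v i (0 : H i)) = 0.
Proof. by have := F_multi v (-1) (0 : H i) 0; rewrite scaler0 addr0 scaleN1r addNr. Qed.

Let FB v i (x y : H i) : F (dfwith v i (x - y)) = F (dfwith v i x) - F (dfwith v i y).
Proof. by rewrite addrC -scaleN1r F_multi scaleN1r addrC. Qed.

Let dfwith_twice v i j (x : H i) (y : H j) : i != j ->
  dfwith (dfwith v i x) j y = dfwith (dfwith v j y) i x.
Proof.
move=> ij; apply: functional_extensionality_dep => k.
have [<-|jk] := eqVneq j k; first by rewrite dfwithin dfwithout// dfwithin.
rewrite dfwithout//; have [<-|ik] := eqVneq i k; first by rewrite !dfwithin.
by rewrite !dfwithout.
Qed.

Let dfwith_same v i (x y : H i) : dfwith (dfwith v i x) i y = dfwith v i y.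
Proof.
apply: functional_extensionality_dep => k.
have [<-|ik] := eqVneq i k; first by rewrite !dfwithin.
by rewrite !dfwithout.
Qed.

(* Invariance under X (x) f and Y (x) 1 gives invariance under [X, Y] (x) f, so
   that it is enough to check root vectors. *)
Let F_invariant : is_gauge_invariant X F.
Proof.
rewrite /is_gauge_invariant; apply: simple_generated => [|Y Z YF ZF f s v fX sf|a Y ra aY f s v fX sf]; last first.
- have [m mX mT] := T_root ra aY; have [f' f'X sf'] := mX _ _ fX sf.
  rewrite -[RHS](coinv_class_invariant Y (fun i => T (v i)) f'X sf').
  by apply: eq_bigr => i _; rewrite /F Tdfwith mT.
- pose x i := act (h := H i) (loop Y (s i)); pose z i := act (h := H i) (loop Z 1).
  have one : regular_away X 1 /\ forall i, is_expansion X i 1 1.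
    split=> [|i]; exists 1, 1; split; rewrite ?oner_neq0 ?rmorph1 ?divr1 ?mul1r ?rmorph1//.
    - by move=> p; rewrite rootC oner_eq0.
    - by right.
  have xz i u : act (loop (lie Y Z) (s i)) u = x i (z i u) - z i (x i u).
    rewrite /x /z act_loopC mulr1 mul1r res_sderiv mulr0 mul0r scale0r addr0.
    by rewrite [X in _ = X - _]addrC addrK.
  have sum1 : \sum_j \sum_i F (dfwith (dfwith v j (z j (v j))) i
      (x i (dfwith v j (z j (v j)) i))) = 0.
    by rewrite big1// => j _; exact: YF fX sf.
  have sum2 : \sum_j \sum_i F (dfwith (dfwith v i (x i (v i))) j
      (z j (dfwith v i (x i (v i)) j))) = 0.
    by rewrite exchange_big big1// => i _; exact: ZF one.1 one.2.
  (* In the difference of the two double sums the terms at distinct points cancel, and each diagonal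
     term is the action of the bracket. *)
  have {sum1 sum2} := congr2 (fun s1 s2 => s1 - s2) sum1 sum2.
  rewrite subrr -sumrB => e; rewrite -[RHS]e; apply: eq_bigr => j _.
  rewrite -sumrB (bigD1 j)//= big1 ?addr0 => [|i ij].
    by rewrite !dfwithin !dfwith_same xz FB.
  have vi (u : H j) : dfwith v j u i = v i by rewrite dfwithout// eq_sym.
  have vj (u : H i) : dfwith v i u j = v j by rewrite dfwithout.
  by rewrite vi vj dfwith_twice ?subrr// eq_sym.
- split=> [f s v fX sf|c Y Z YF ZF f s v fX sf].
    by rewrite big1// => i _; rewrite loop0l act0l F0.
  transitivity (\sum_(i < n) (c *: F (dfwith v i (act (loop Y (s i)) (v i))) +
      F (dfwith v i (act (loop Z (s i)) (v i))))).
    by apply: eq_bigr => i _; rewrite loop_linearl actDl actZl F_multi.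
  by rewrite big_split -scaler_sumr /= (YF _ _ _ fX sf) (ZF _ _ _ fX sf) scaler0 addr0.
Qed.

Lemma coinvariants_map : exists2 G : coinvariants X H -> coinvariants X H', linear G &
  forall v, G (coinv_class X v) = coinv_class X (fun i => T (v i)).
Proof.
exists (coinv_lift F); first exact: coinv_lift_linear F_multi F_invariant.
exact: coinv_liftE F_multi F_invariant.
Qed.

End CoinvariantsMap.

Section CoinvariantsIso.
Variables (K : numFieldType) (g : simpleLie K) (l n : nat) (X : pointedLine K n).
Variables (lam lam' : 'I_n -> weight g).
Variables (H : forall i, hwModule l (lam i)) (H' : forall i, hwModule l (lam' i)).
Variable nus : 'I_n -> cartan_elt g.
Hypotheses (nusC : forall j, is_coweight (nus j)) (nus0 : \sum_j nus j = 0).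

Lemma root_values (a : weight g) : is_root a ->
  exists2 k : 'I_n -> int, \sum_j k j = 0 & forall j, a (nus j) = (k j)%:~R :> K.
Proof.
move=> ra; have [k kE] := choice (fun j => nusC j ra); exists k => //.
apply: (@intr_inj K); rewrite rmorph_sum /=.
transitivity (a (\sum_j nus j) : K); last by rewrite nus0 linear0.
by rewrite linear_sum; apply: eq_bigr => j _; exact/esym/kE.
Qed.

(** The inverses of the T_i twist by the reciprocal functions, with exponents - k_j again of sum 0,
    so they descend too; the two induced maps are inverse on classes of tuples. *)
Lemma coinvariants_iso (T : forall i, H i -> H' i) :
  (forall i, is_twist nus (twist_series X ^~ i) (@T i)) ->
  exists2 G : coinvariants X H -> coinvariants X H', linear G /\ bijective G &
    forall v, G (coinv_class X v) = coinv_class X (fun i => T i (v i)).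
Proof.
move=> Tt; have Sex i : exists S : H' i -> H i, cancel (@T i) S /\ cancel S (@T i).
  by have [_ [S TS ST] _] := Tt i; exists S.
pose S i := sval (cid (Sex i)).
have TS i : cancel (@T i) (S i) by exact: (svalP (cid (Sex i))).1.
have ST i : cancel (S i) (@T i) by exact: (svalP (cid (Sex i))).2.
have TL i : linear (@T i) by have [] := Tt i.
have SL i : linear (S i) by move=> a u v; apply: (can_inj (TS i)); rewrite TL !ST.
have [||G GL GE] := @coinvariants_map _ _ _ _ X _ _ H H' T => //.
  move=> a Y ra aY; have [k k0 ak] := root_values ra.
  exists (twist_series X k) => [|i f v]; first exact: twist_series_multiplier.
  by have [_ _ TE] := Tt i; exact: (TE a).
have [||F FL FE] := @coinvariants_map _ _ _ _ X _ _ H' H S => //.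
  move=> a Y ra aY; have [k k0 ak] := root_values ra.
  exists (twist_series X (fun j => - k j)) => [|i f v].
    by apply: twist_series_multiplier; rewrite sumrN k0 oppr0.
  apply: (can_inj (TS i)); have [_ _ TE] := Tt i.
  by rewrite ST (TE a Y k)// ST mulrA twist_seriesV mul1r.
exists G => //; split=> //; exists F.
- apply: (coinvariants_ext (F := F \o G) (G := id)) => [a u v|//|v] /=.
    by rewrite GL FL.
  by rewrite GE FE; congr coinv_class; apply: functional_extensionality_dep => i; rewrite TS.
- apply: (coinvariants_ext (F := G \o F) (G := id)) => [a u v|//|v] /=.
    by rewrite FL GL.
  by rewrite FE GE; congr coinv_class; apply: functional_extensionality_dep => i; rewrite ST.
Qed.

End CoinvariantsIso.

Lemma nondegenerate_transfer (K : fieldType) (U V V' W W' : lmodType K)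
    (B : U -> V -> W) (B' : U -> V' -> W') (F : V -> V') (G : W -> W') :
  linear F -> bijective F -> linear G -> bijective G ->
  (forall u v, B' u (F v) = G (B u v)) ->
  nondegenerate_pairing B <-> nondegenerate_pairing B'.
Proof.
move=> /linear_packed[F1 F1E] [F' FK KF] /linear_packed[G1 G1E] [G' GK KG] BF.
have F0 : F 0 = 0 by rewrite -F1E linear0.
have G0 : G 0 = 0 by rewrite -G1E linear0.
have BE u v' : B' u v' = G (B u (F' v')) by rewrite -BF KF.
have B0 u v : (B' u (F v) = 0) <-> (B u v = 0).
  by rewrite BF; split=> [e|->//]; apply: (can_inj GK); rewrite e G0.
split=> -[BU BV]; split=> [u uB|v vB].
- by apply: BU => v; apply/B0; exact: uB.
- rewrite -[v]KF [F' v]BV ?F0// => u; apply/B0; rewrite KF; exact: vB.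
- by apply: BU => v; rewrite -[v]KF; apply/B0; exact: uB.
- apply: (can_inj FK); rewrite F0; apply: BV => u; apply/B0; exact: vB.
Qed.

Local Open Scope complex_scope.

(** * Transport of intertwiners and of rank-level duality maps *)

Section LocalTransport.
Variables (K : numFieldType) (g1 g2 g : simpleLie K).
Variables (phi : {linear (g1 * g2)%type -> g}) (l1 l2 n : nat) (X : pointedLine K n).
Variable mu : 'I_n -> cartan_elt g2.
Local Notation nu := (fun j => phi_cartan phi (mu j)).
Hypotheses (phi_emb : is_lie_embedding phi) (phi_index : has_dynkin_index phi l1 l2).
Hypothesis phi_cartanP : preserves_cartan phi.
Hypotheses (muC : forall j, is_coweight (mu j)) (nuC : forall j, is_coweight (nu j)).

Lemma local_transport (i : 'I_n) (lam : weight g1) (gam ogam : weight g2)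
    (Lam OLam : weight g) (H1 : hwModule l1 lam) (H2 : hwModule l2 gam)
    (H2' : hwModule l2 ogam) (H : hwModule 1%N Lam) (H' : hwModule 1%N OLam)
    (psi : H1 -> H2 -> H) (psi' : H1 -> H2' -> H') :
  shift_intertwined (mu i) H2 H2' -> shift_intertwined (nu i) H H' ->
  multiplicity_one phi H1 H2 H ->
  is_branching phi psi -> is_nonzero psi -> is_branching phi psi' -> is_nonzero psi' ->
  exists (T2 : H2 -> H2') (T : H -> H'),
    [/\ is_twist mu (twist_series X ^~ i) T2, is_twist nu (twist_series X ^~ i) T &
        forall v w, psi' v (T2 w) = T (psi v w)].
Proof.
move=> [sigma [Theta2 [sh2 b2 E2]]] [sigma' [Theta [sh b E]]] mult psiB psiN pB pN.
have [d d0 dE] := branching_transfer phi_emb phi_index phi_cartanP (muC i) (nuC i) sh2 sh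
  b2 b E2 E mult psiB psiN pB pN.
have [c [p [c0 p1 cpE]]] := twist_seriesE X i.
have [R2 [R [R2t Rt RE]]] := twist_pair phi_cartanP mu psiB c0 p1.
(* [R2] and [R] supply the unit part of the expansion, the shifts supply xi^(k_i), and the scalar d
   from multiplicity one is absorbed into the map on the modules of g. *)
exists (Theta2 \o R2), ( *:%R d \o (Theta \o R)); split=> [||v w].
- by apply: twist_ext (twist_comp R2t (twist_shift sh2 b2 E2)) => k k0; rewrite cpE.
- apply: twist_ext (twist_comp (twist_comp Rt (twist_shift (i := i) sh b E))
    (twist_scale _ _ d0)) => k k0.
  by rewrite cpE// mul1r.
- by rewrite /= dE RE.
Qed.

End LocalTransport.

Theorem corollary2 (R : realType) (g1 g2 g : simpleLie R[i])
    (phi : {linear (g1 * g2)%type -> g}) (l1 l2 n : nat)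
    (X : pointedLine R[i] n)
    (lam : 'I_n -> weight g1) (gam : 'I_n -> weight g2) (Lam : 'I_n -> weight g)
    (H1 : forall i, hwModule l1 (lam i)) (H2 : forall i, hwModule l2 (gam i))
    (H : forall i, hwModule 1%N (Lam i))
    (mu : 'I_n -> cartan_elt g2)
    (omega : 'I_n -> weight g2 -> weight g2) (Omega : 'I_n -> weight g -> weight g)
    (ogam : 'I_n -> weight g2) (OLam : 'I_n -> weight g)
    (H2' : forall i, hwModule l2 (ogam i)) (H' : forall i, hwModule 1%N (OLam i))
    (B : coinvariants X H1 -> coinvariants X H2 -> coinvariants X H)
    (B' : coinvariants X H1 -> coinvariants X H2' -> coinvariants X H') :
  is_lie_embedding phi ->
  has_dynkin_index phi l1 l2 ->
  preserves_cartan phi ->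
  (forall i, level_weights l1 (lam i)) ->
  (forall i, level_weights l2 (gam i)) ->
  (forall i, level_weights 1%N (Lam i)) ->
  (forall i, multiplicity_one phi (H1 i) (H2 i) (H i)) ->
  (forall i, is_coweight (mu i)) ->
  \sum_(i < n) mu i = 0 ->
  (forall i, is_coweight (phi_cartan phi (mu i))) ->
  (forall i, is_attached (mu i) (omega i)) ->
  (forall i, is_attached (phi_cartan phi (mu i)) (Omega i)) ->
  (forall i, is_permuted (omega i) l2 (gam i) (ogam i)) ->
  (forall i, is_permuted (Omega i) 1%N (Lam i) (OLam i)) ->
  is_rank_level_map phi B ->
  is_rank_level_map phi B' ->
  nondegenerate_pairing B <-> nondegenerate_pairing B'.
Proof.
move=> emb dyn cart _ gamP LamP mult muC mu0 nuC att2 att perm2 perm.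
move=> [[BL BR] [psi [psiP BE]]] [[BL' BR'] [psi' [psiP' BE']]].
pose nu j := phi_cartan phi (mu j).
have nu0 : \sum_j nu j = 0.
  apply: val_inj; rewrite linear_sum /=.
  under eq_bigr do rewrite phi_cartanE//.
  by rewrite -linear_sum -linear_sum mu0 !linear0.
have trans i : exists TT : (H2 i -> H2' i) * (H i -> H' i),
    [/\ is_twist mu (twist_series X ^~ i) TT.1, is_twist nu (twist_series X ^~ i) TT.2 &
        forall v w, psi' i v (TT.1 w) = TT.2 (psi i v w)].
  have [T2 [T TP]] := local_transport X emb dyn cart muC nuC
    ((att2 i).2 _ _ _ (H2 i) (H2' i) (gamP i) (perm2 i))
    ((att i).2 _ _ _ (H i) (H' i) (LamP i) (perm i))
    (mult i) (psiP i).1 (psiP i).2 (psiP' i).1 (psiP' i).2.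
  by exists (T2, T).
pose T2 i := (sval (cid (trans i))).1; pose T i := (sval (cid (trans i))).2.
have T2t i : is_twist mu (twist_series X ^~ i) (T2 i) by case: (svalP (cid (trans i))).
have Tt i : is_twist nu (twist_series X ^~ i) (T i) by case: (svalP (cid (trans i))).
have psiT i v w : psi' i v (T2 i w) = T i (psi i v w) by case: (svalP (cid (trans i))) => _ _; apply.
have [F [FL Fb] FE] := coinvariants_iso muC mu0 T2t.
have [G [GL Gb] GE] := coinvariants_iso nuC nu0 Tt.
apply: (nondegenerate_transfer FL Fb GL Gb) => p q.
(* Both sides are bilinear, so it suffices to compare them on classes of tuples, first in the second
   argument and then in the first. *)
apply: (coinvariants_ext (F := B' p \o F) (G := G \o B p)) => [a x y|a x y|w] /=.
- by rewrite FL BR'.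
- by rewrite BR GL.
rewrite FE; apply: (coinvariants_ext (F := B' ^~ _) (G := fun p => G (B p _))) => [|a x y|v].
- exact: BL'.
- by rewrite BL GL.
rewrite BE BE' GE; congr coinv_class; apply: functional_extensionality_dep => i.
exact: psiT.
Qed.
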